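(* There exists a finitely generated amenable group $G$ such that, with $\rho$ the left-invariant word metric on $G$ associated to a finite symmetric generating set, the following holds: for every $p\in[1,\infty)$ and every $\alpha>0$ there is no injection $f:G\to L_p$ for which there is a constant $c>0$ such that $$c\,\rho(g,h)^{\alpha}\le \|f(g)-f(h)\|_{L_p}\le \rho(g,h)\qquad\text{for all } g,h\in G.$$ (That is, a single finitely generated amenable group admits no embedding into $L_p$ with a positive compression exponent, for any $p\in[1,\infty)$.)
   Context: $L_p$ denotes the Lebesgue space $L_p$ with its norm metric. The existence of such an $f$ for a given $\alpha$ does not depend on the choice of finite symmetric generating set of $G$, since different finite generating sets give bi-Lipschitz equivalent word metrics. The compression exponent of $(G,\rho)$ into $L_p$ is the supremum of those $\alpha\ge 0$ for which an injection $f$ as displayed (for some $c>0$) exists. *)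

(* Defs.v *)
From HB Require Import structures.
From mathcomp Require Import all_boot all_order all_algebra.
From mathcomp Require Import all_classical all_reals all_analysis.
Set Implicit Arguments.
Unset Strict Implicit.
Unset Printing Implicit Defensive.
Import Order.TTheory GRing.Theory Num.Theory.
Local Open Scope classical_set_scope.
Local Open Scope ring_scope.

Section WordMetric.
Variable G : groupType.
Implicit Types (S H : set G) (g h : G).

Definition subgroup H : Prop :=
  [/\ H 1%g, (forall g h, H g -> H h -> H (g * h)%g)
    & (forall g, H g -> H g^-1%g)].

Definition generates S : Prop := smallest subgroup S = setT.

Definition symmetric_set S : Prop := forall g, S g -> S g^-1%g.

Definition finite_symmetric_generating S : Prop :=
  [/\ finite_set S, symmetric_set S & generates S].

Definition word_of_size S g (n : nat) : Prop :=
  exists w : seq G,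
    [/\ size w = n, (forall x, x \in w -> S x)
      & \big[*%g/1%g]_(x <- w) x = g].

(* The default value 0 is used only when no word in S represents g, which
   cannot happen when S is a symmetric generating set. *)
Definition word_length S g : nat :=
  xget 0%N [set n | word_of_size S g n /\
                    (forall m, word_of_size S g m -> (n <= m)%N)].

Definition word_metric S g h : nat := word_length S (g^-1 * h)%g.

End WordMetric.

Definition finitely_generated (G : groupType) : Prop :=
  exists S : set G, finite_set S /\ generates S.

(* Amenability of a discrete group: a left-invariant finitely additive
   probability measure defined on all subsets. *)
Definition amenable (R : realType) (G : groupType) : Prop :=
  exists m : set G -> R,
    [/\ (forall A, 0 <= m A), m setT = 1,
        (forall A B, A `&` B = set0 -> m (A `|` B) = m A + m B)
      & (forall (g : G) A, m [set (g * x)%g | x in A] = m A)].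

Section Lebesgue01.
Variable R : realType.

Definition lebesgue01 : {measure set (measurableTypeR R) -> \bar R} :=
  mrestr (@lebesgue_measure R) (measurable_itv `[0, 1]).

(* L_p([0, 1]), as a.e.-equivalence classes; functions are defined on the whole
   line but their values outside [0, 1] are ignored by the measure. *)
Definition Lp (p : R) (p1 : (1 <= p%:E)%E) := LspaceType lebesgue01 p1.

Definition Lp_dist (p : R) (p1 : (1 <= p%:E)%E) (u v : Lp p1) : \bar R :=
  Lnorm lebesgue01 p%:E (fun x => ((u x : R) - (v x : R))%:E).

End Lebesgue01.

(* Main.v *)
(** A finite group carrying a multiset of generators with a spectral gap embeds
    badly into every L_p: the Poincare inequality bounds the average distance
    of the image points by the length of the generators.  So it suffices to
    find, inside a finitely generated amenable group G, finite subgroups F_2^k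
    with generators of length subpolynomial in k having a spectral gap; since
    balls of G grow at most exponentially, most of the 2^k elements have length
    at least of order k.

    The generators come from Reed-Muller codes: for M variables, index F_2^k by
    the r-subsets of the variables and map h to c_h, the values at h of all
    monomials of degree r.  A nonzero character is a nonzero homogeneous
    polynomial of degree r, and takes the value -1 on a proportion at least
    2^-r of the c_h.  With M = r 2^r one has k >= 2^(r^2).

    G acts on (configurations of lamps on Z) x {0, 1} x F_2^(N x N).  It is
    generated by the shift of the lamps, the flip of the lamp 0, the swap of
    the two sheets above the dark configuration, and the translation of the
    upper sheet by color(x) above x.  If g moves the dark configuration 0 to x,
    the commutator of the swap with the conjugate by g of the last generator
    translates both sheets above 0 by color(x) and nothing else, so its length
    is linear in that of g; choosing the function color suitably, one obtains
    all vectors c_h with length polynomial in M.  G is amenable since it is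
    locally-finite-by-Z: the conjugates of the three involutions by powers of
    the shift are iterated skew products with fibres of exponent 2, so finitely
    many of them generate a finite group. *)

Require Import Defs.
From HB Require Import structures.
From mathcomp Require Import all_boot all_order all_algebra.
From mathcomp Require Import all_classical all_reals all_analysis.
From mathcomp Require Import measurable_realfun zify ring lra.
Set Implicit Arguments.
Unset Strict Implicit.
Unset Printing Implicit Defensive.
Import Order.TTheory GRing.Theory Num.Theory.
Import numFieldNormedType.Exports.
Local Open Scope ring_scope.

(** * Fourier analysis on the Boolean cube *)

Section BooleanCube.
Variable J : finType.
Local Notation Q := {ffun J -> bool}.

Definition dot (w x : Q) : bool := \sum_j (w j && x j : bool).

Definition unit_vec (j : J) : Q := [ffun i => i == j].

Lemma dotC w x : dot w x = dot x w.
Proof. by apply: eq_bigr => j _; rewrite andbC. Qed.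

Lemma dotDr w x y : dot w (x + y) = dot w x + dot w y.
Proof.
rewrite /dot -big_split; apply: eq_bigr => j _.
by rewrite ffunE; case: (w j).
Qed.

Lemma dot_unit x j : dot (unit_vec j) x = x j.
Proof.
rewrite /dot (bigD1 j)//= ffunE eqxx big1 ?addr0//.
by move=> i ij; rewrite ffunE (negbTE ij).
Qed.

Lemma cube_addxx (x : Q) : x + x = 0.
Proof. by apply/ffunP => j; rewrite !ffunE; case: (x j). Qed.

Lemma cube_addK (y : Q) : cancel (+%R^~ y) (+%R^~ y).
Proof. by move=> x; rewrite -addrA cube_addxx addr0. Qed.

Lemma cube_unit_sum (x : Q) : x = \sum_(j | x j) unit_vec j.
Proof.
apply/ffunP => i; rewrite sum_ffunE; case: (boolP (x i)) => xi.
  rewrite (bigD1 i)//= ffunE eqxx big1 ?addr0// => j /andP[_ ji].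
  by rewrite ffunE eq_sym (negbTE ji).
rewrite big1// => j xj; rewrite ffunE; apply/negbTE.
by apply: contra xi => /eqP ->.
Qed.

Section Fourier.
Variable R : realFieldType.
Implicit Types (F : Q -> R) (c w x y : Q).

Definition character w x : R := (-1) ^+ dot w x.

Definition fourier F w : R := \sum_x F x * character w x.

Lemma characterD w x y : character w (x + y) = character w x * character w y.
Proof. by rewrite /character dotDr -signr_addb. Qed.

Lemma sum_character x : \sum_w character w x = #|{: Q}|%:R *+ (x == 0).
Proof.
case: eqVneq => [->|x0].
  rewrite -sumr_const; apply: eq_bigr => w _.
  by rewrite /character /dot big1// => j _; rewrite ffunE andbF.
have [j xj] : exists j, x j.
  apply/existsP; apply: contra_neqT x0 => /existsPn xj.
  by apply/ffunP => j; rewrite ffunE; apply/negbTE/xj.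
(* Translating [w] by the unit vector at a coordinate where [x] is 1 reverses the sign of every
   term. *)
suff /eqP : \sum_w character w x = - \sum_w character w x.
  by rewrite -addr_eq0 -mulr2n mulrn_eq0/= => /eqP.
rewrite [LHS](reindex_inj (can_inj (cube_addK (unit_vec j))))/=.
rewrite -sumrN; apply: eq_bigr => w _.
rewrite /character dotC dotDr dotC [X in _ + X]dotC dot_unit xj.
by case: (dot w x); rewrite /= ?expr0 ?expr1 ?opprK.
Qed.

Lemma parseval F : \sum_w fourier F w ^+ 2 = #|{: Q}|%:R * \sum_x F x ^+ 2.
Proof.
transitivity (\sum_x \sum_y \sum_w F x * F y * character w (x + y)).
  rewrite [RHS](eq_bigr (fun x => \sum_w \sum_y F x * F y * character w (x +
    y))).
    rewrite exchange_big; apply: eq_bigr => w _.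
    rewrite expr2 /fourier big_distrlr/=; apply: eq_bigr => x _.
    by apply: eq_bigr => y _; rewrite characterD mulrACA.
  by move=> x _; rewrite exchange_big.
rewrite mulr_sumr; apply: eq_bigr => x _.
rewrite (bigD1 x)//= -mulr_sumr sum_character cube_addxx eqxx mulr1n.
rewrite big1 ?addr0 => [|y yx]; first by rewrite expr2 mulrC.
rewrite -mulr_sumr sum_character (_ : (x + y == 0) = false) ?mulr0//.
apply/negbTE; apply: contra yx => /eqP xy0.
by rewrite -(addr0 y) -(cube_addxx x) addrCA [y + x]addrC xy0 addr0.
Qed.

Lemma fourier_diff F c w :
  fourier (fun x => F (x + c) - F x) w = (character w c - 1) * fourier F w.
Proof.
rewrite mulrBl mul1r /fourier.
under eq_bigr do rewrite mulrBl.
rewrite sumrB; congr (_ - _).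
rewrite (reindex_inj (can_inj (cube_addK c)))/= mulr_sumr.
apply: eq_bigr => x _; rewrite cube_addK characterD; ring.
Qed.

Lemma character_sub1_sq w c : (character w c - 1) ^+ 2 = 4%:R *+ dot w c.
Proof. by rewrite /character; case: dot; rewrite /= ?mulr1n ?mulr0n; ring. Qed.

Lemma energyE F (c : Q) : #|{: Q}|%:R * \sum_(x : Q) (F (x + c) - F x) ^+ 2 =
  \sum_w (4%:R *+ dot w c) * fourier F w ^+ 2.
Proof.
rewrite -parseval; apply: eq_bigr => w _.
by rewrite fourier_diff exprMn character_sub1_sq.
Qed.

Lemma sum_energyE (H : finType) (c : H -> Q) F :
  #|{: Q}|%:R * \sum_h \sum_(x : Q) (F (x + c h) - F x) ^+ 2 =
  4%:R * \sum_w #|[pred h | dot w (c h)]|%:R * fourier F w ^+ 2.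
Proof.
rewrite [LHS]mulr_sumr (eq_bigr _ (fun h _ => energyE F (c h))).
rewrite exchange_big [RHS]mulr_sumr; apply: eq_bigr => w _ /=.
rewrite -mulr_suml mulrA; congr (_ * _).
rewrite -sum1_card natr_sum mulr_sumr.
rewrite [RHS]big_mkcond/=; apply: eq_bigr => h _.
by rewrite inE; case: dot; rewrite ?mulr1.
Qed.

(** Both sides are weighted sums of the squares [fourier F w ^+ 2], so it is enough to compare
    weights. On the left, the number of [y] with [dot w y] is at most the size of the cube; on the
    right, [gap] applies. The frequency [w = 0] has weight 0 on the left. *)
Lemma poincare_sq (H : finType) (c : H -> Q) (lam : R) :
  (forall w, w != 0 -> lam * #|H|%:R <= #|[pred h | dot w (c h)]|%:R) ->
  0 <= lam -> forall F,
  lam * #|H|%:R * \sum_(y : Q) \sum_(x : Q) (F (x + y) - F x) ^+ 2 <=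
  #|{: Q}|%:R * \sum_h \sum_(x : Q) (F (x + c h) - F x) ^+ 2.
Proof.
move=> gap lam0 F.
have Q0 : 0 < #|{: Q}|%:R :> R by rewrite ltr0n; apply/card_gt0P; exists 0.
rewrite -(ler_pM2l Q0) mulrCA (sum_energyE id) sum_energyE.
rewrite mulrCA [leRHS]mulrCA ler_pM2l// !mulr_sumr; apply: ler_sum => w _.
rewrite [leLHS]mulrA [leRHS]mulrA ler_wpM2r ?sqr_ge0//.
have [->|w0] := eqVneq w 0.
  rewrite (_ : #|_| = 0%N) ?mulr0 ?mulr_ge0 ?ler0n//.
  by apply: eq_card0 => y; rewrite inE /dot big1// => j _; rewrite ffunE.
rewrite [leRHS]mulrC ler_pM ?mulr_ge0 ?ler0n ?gap//.
by rewrite ler_nat max_card.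
Qed.

End Fourier.
End BooleanCube.

(** * Reed-Muller codes *)

Section ReedMuller.
Variables M r : nat.

Definition rset : finType := {A : {set 'I_M} | #|A| == r}.
Local Notation Q := {ffun rset -> bool}.

Definition monomials (h : {set 'I_M}) : Q := [ffun A : rset => sval A \subset
  h].

Lemma monomials_rset (A : rset) : monomials (sval A) = unit_vec A.
Proof.
apply/ffunP => B; rewrite !ffunE; apply/idP/eqP => [BA|->//].
by apply/val_inj/eqP; rewrite eqEcard BA (eqP (svalP A)) (eqP (svalP B))/=.
Qed.

(** The subsets [h] and [i |: h] of [A0] contribute equal bits, which cancel modulo 2. *)
Lemma sum_toggle_eq0 (A0 : {set 'I_M}) (i : 'I_M) (f : {set 'I_M} -> bool) :
  i \in A0 -> (forall h : {set 'I_M}, i \notin h -> f (i |: h) = f h) ->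
  \sum_(h : {set 'I_M} | h \subset A0) f h = 0.
Proof.
move=> iA0 fi; rewrite (bigID (fun h : {set 'I_M} => i \in h))/=.
rewrite (reindex_onto (fun h : {set 'I_M} => i |: h) (fun h : {set 'I_M} => h
  :\ i)) /=; last first.
  by move=> h /andP[_ ih]; rewrite finset.setD1K.
rewrite (eq_big (fun h : {set 'I_M} => (h \subset A0) && (i \notin h)) f).
- by case: (\sum_(_ | _) _).
- move=> h; rewrite finset.subUset finset.sub1set iA0 finset.setU11 andbT;
  congr andb.
  have [ih|ih] := boolP (i \in h); last by rewrite finset.setU1K ?eqxx.
  by apply/negbTE; apply: contraTneq ih => <-; rewrite finset.setD11.
- by move=> h /andP[_ /eqP hE]; apply: fi; rewrite -hE finset.setD11.
Qed.

(* Among the restrictions of the polynomial [w] to the cubes obtained by fixing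
   the variables outside [A0], where [A0] is a monomial of [w], each one still
   has the monomial [A0] and hence does not vanish identically. *)
Lemma reed_muller_odd_sum (w : Q) (A0 : rset) (g : {set 'I_M}) : w A0 ->
  [disjoint g & sval A0] ->
  \sum_(h : {set 'I_M} | h \subset sval A0) dot w (monomials (g :|: h)) = true.
Proof.
move=> wA0 gA0; rewrite /dot exchange_big /= (bigD1 A0)//= [X in _ + X]big1.
  rewrite addr0 (bigD1 (sval A0))//= big1 => [|h /andP[hA0 hn]].
    by rewrite addr0 wA0 ffunE finset.subsetUr.
  rewrite wA0 ffunE/=; apply/negbTE; apply: contra hn => A0gh.
  rewrite finset.eqEsubset hA0/=; apply/fintype.subsetP => i iA0.
  have := fintype.subsetP A0gh i iA0; rewrite finset.inE => /orP[ig|//].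
  by move: gA0; rewrite disjoint_sym => /disjointFr /(_ iA0); rewrite ig.
move=> A AA0; have [wA|wA] := boolP (w A); last first.
  by rewrite big1// => h _; rewrite (negbTE wA).
(* [A] and [A0] are distinct of the same size, so [A] misses some variable of [A0]; toggling it does
   not affect the monomial [A]. *)
have [i /andP[iA0 iA]] : exists i, (i \in sval A0) && (i \notin sval A).
  apply/existsP; apply: contraNT AA0 => /existsPn H.
  apply/eqP/esym/val_inj/eqP; rewrite eqEcard (eqP (svalP A)) (eqP (svalP A0)).
  rewrite leqnn andbT; apply/fintype.subsetP => i iA0.
  by have := H i; rewrite iA0 /= negbK.
apply: sum_toggle_eq0 iA0 _ => h ih; rewrite !ffunE; congr andb.
apply/idP/idP => /fintype.subsetP s; apply/fintype.subsetP => j jA;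
  have := s j jA;
  rewrite !finset.inE; last by move/orP => [] ->; rewrite ?orbT.
by case: eqP => // ji; rewrite -ji jA in iA.
Qed.

(** Each of the [2 ^ (M - r)] assignments outside a monomial [A0] of [w] extends to a point where
    [w] is 1, so removing [A0] maps the support of [w] onto these assignments. *)
Lemma reed_muller_gap (w : Q) : w != 0 ->
  (2 ^ (M - r) <= #|[pred h | dot w (monomials h)]|)%N.
Proof.
move=> w0; have [A0 wA0] : exists A, w A.
  apply/existsP; apply: contra_neqT w0 => /existsPn H.
  by apply/ffunP => A; rewrite ffunE; apply/negbTE/H.
have <- : #|powerset (~: sval A0)| = (2 ^ (M - r))%N.
  by rewrite card_powerset cardsCs finset.setCK card_ord (eqP (svalP A0)).
apply: leq_trans (leq_imset_card (fun h : {set 'I_M} => h :\: sval A0) _).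
apply/subset_leq_card/fintype.subsetP => g; rewrite powersetE => gA0.
have gdis : [disjoint g & sval A0] by rewrite finset.disjoints_subset.
have [h /andP[hA0 hw]] : exists h : {set 'I_M},
    (h \subset sval A0) && dot w (monomials (g :|: h)).
  apply/existsP; have := reed_muller_odd_sum wA0 gdis.
  apply: contra_eqT => /existsPn H; rewrite big1// => h hA0.
  by have := H h; rewrite hA0 => /negbTE.
apply/imsetP; exists (g :|: h); rewrite ?inE//.
rewrite finset.setDUl (eqP (_ : h :\: _ == finset.set0)) ?finset.setD_eq0//.
by rewrite finset.setU0; apply/esym/finset.setDidPl.
Qed.

Lemma card_rset : #|{: rset}| = 'C(M, r).
Proof. by rewrite card_sig -[in RHS](card_ord M) -card_draws cardsE. Qed.

End ReedMuller.

Lemma binomial_lower_bound q r : (q ^ r <= 'C(r * q, r))%N.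
Proof.
elim: r => [|r IH]; first by rewrite bin0.
case: q IH => [|q] IH; first by rewrite exp0n.
rewrite -(leq_pmul2l (ltn0Sn r)) -mul_bin_diag expnS mulnA leq_mul2l.
apply/orP; right; apply: leq_trans IH _; apply: leq_bin2l.
by rewrite mulSn; lia.
Qed.

(** * Poincare inequalities in L_p *)

Lemma bernoulli_expr (R : realFieldType) (t : R) n : 0 <= t <= 1 ->
  1 - n%:R * (1 - t) <= t ^+ n.
Proof.
move=> /andP[t0 t1]; elim: n => [|n IH]; first by rewrite expr0 mul0r subr0.
have tn1 : t ^+ n <= 1 by rewrite exprn_ile1.
by rewrite exprS -natr1; nra.
Qed.

(** [s] is the least value of [F] with at least half of the points at or below it. If fewer than
    half were at or above [s], the largest value below [s] would already have this property. *)
Lemma finite_median (R : realDomainType) (T : finType) (F : T -> R) (x0 : T) :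
  exists s, (#|T| <= 2 * #|[pred x | (F x <= s)%R]|)%N /\
            (#|T| <= 2 * #|[pred x | (s <= F x)%R]|)%N.
Proof.
pose P x := (#|T| <= 2 * #|[pred y | (F y <= F x)%R]|)%N.
have [xM _ hM] := @arg_maxP _ _ _ x0 xpredT F isT.
have PM : P xM.
  rewrite /P; have -> : #|[pred y | (F y <= F xM)%R]| = #|T|.
    by apply: eq_card => y; rewrite !inE; exact: hM.
  by rewrite mul2n -addnn leq_addr.
have [x Px hx] := @arg_minP _ _ _ xM P F PM.
exists (F x); split=> //; rewrite leqNgt; apply/negP => lt.
pose A : {pred T} := [pred y | (F x <= F y)%R].
have cC : (#|A| + #|predC A| = #|T|)%N := cardC A.
have lt' : (2 * #|A| < #|T|)%N := lt.
have lt2 : (#|T| < 2 * #|predC A|)%N.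
  by move: cC lt'; move: #|A| #|predC A| #|T| => a b t; lia.
have [y0 Py0] : exists y, F y < F x.
  have /card_gt0P[y yP] : (0 < #|predC A|)%N by lia.
  by exists y; move: yP; rewrite !inE -ltNge.
have [y Py hy] := @arg_maxP _ _ _ y0 (fun y => F y < F x) F Py0.
suff /hx : P y by rewrite leNgt Py.
rewrite /P.
have -> : #|[pred z | (F z <= F y)%R]| = #|predC A|.
  apply: eq_card => z; rewrite !inE -ltNge.
  by apply/idP/idP => [zy|zx]; [exact: le_lt_trans zy Py|exact: hy].
exact: ltnW.
Qed.

(** * The Mazur map on the real line *)

Section SignedPower.
Variable R : realType.
Implicit Types (p q a b eta : R).

Definition signed_powR q a : R := Num.sg a * (`|a| `^ q).

Lemma signed_powRN q a : signed_powR q (- a) = - signed_powR q a.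
Proof. by rewrite /signed_powR sgrN normrN mulNr. Qed.

Lemma signed_powR_ge0 q a : (0 <= a) -> 0 <= signed_powR q a.
Proof. by move=> a0; rewrite mulr_ge0 ?sgr_ge0 ?powR_ge0. Qed.

Lemma signed_powR_le0 q a : (a <= 0) -> signed_powR q a <= 0.
Proof. by move=> a0; rewrite mulr_le0_ge0 ?sgr_le0 ?powR_ge0. Qed.

Lemma norm_signed_powR q a : 0 < q -> `|signed_powR q a| = `|a| `^ q.
Proof.
move=> q0; rewrite normrM (ger0_norm (powR_ge0 _ _)) normr_sg.
by case: eqVneq => [->|_]; rewrite ?normr0 ?powR0 ?gt_eqF// ?mul0r ?mul1r.
Qed.

Lemma signed_powR_sqr p a : 0 < p -> signed_powR (p / 2) a ^+ 2 = `|a| `^ p.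
Proof.
move=> p0; rewrite -real_normK ?num_real// norm_signed_powR ?divr_gt0//.
by rewrite -powR_mulrn ?powR_ge0// -powRrM divfK ?pnatr_eq0.
Qed.

(* Either [a - b] is comparable with [a], or [a] and [b] have the same sign and
   ratio close to 1, and then Bernoulli's inequality applies. *)
Lemma signed_powR_diff p (P : nat) eta a b : 0 < p <= P%:R -> 0 < eta <= 1 ->
  (signed_powR (p / 2) a - signed_powR (p / 2) b) ^+ 2 <=
  (P%:R * eta) ^+ 2 * (`|a| `^ p + `|b| `^ p)
    + 4 * eta^-1 `^ p * (`|a - b| `^ p).
Proof.
move=> /andP[p0 pP] /andP[e0 e1].
wlog ba : a b / `|b| <= `|a|.
  move=> H; have [ba|/ltW ab] := leP `|b| `|a|; first exact: H.
  by rewrite -sqrrN opprB (addrC (`|a| `^ p)) distrC; exact: H.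
wlog a0 : a b ba / 0 <= a.
  move=> H; have [a0|/ltW a0] := leP 0 a; first exact: H.
  have := H (- a) (- b); rewrite !signed_powRN -!opprD sqrrN !normrN oppr_ge0.
  exact.
have q0 : 0 < p / 2 by rewrite divr_gt0.
have Xge0 x : 0 <= `|x| `^ p by rewrite powR_ge0.
(* In the far case [|b| <= |a|] bounds the difference of the images by twice the image of [|a|], and
   [|a|] is at most [|a - b| / eta]. *)
have [far|near] := leP (eta * `|a|) `|a - b|.
  apply: (@le_trans _ _ (4 * (`|a| `^ p))); last first.
    rewrite -mulrA -powRM ?invr_ge0 ?(ltW e0)// -[leLHS]add0r lerD//.
      by rewrite mulr_ge0 ?sqr_ge0// addr_ge0.
    rewrite ler_pM2l// ge0_ler_powR ?(ltW p0)// ?nnegrE//.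
      by rewrite mulr_ge0// invr_ge0 ltW.
    by rewrite ler_pdivlMl.
  have -> : 4 = 2 ^+ 2 :> R by rewrite -natrX.
  rewrite -(signed_powR_sqr _ p0) -exprMn -real_normK ?num_real//.
  rewrite -[leRHS]real_normK ?num_real// lerXn2r ?nnegrE//.
  rewrite normrM (ger0_norm (ler0n _ 2)) mulr_natl mulr2n.
  apply: le_trans (ler_normB _ _) _; rewrite lerD2l !norm_signed_powR//.
  by rewrite ge0_ler_powR ?nnegrE// ltW.
have {}a0 : 0 < a.
  rewrite lt_neqAle a0 andbT; apply: contraTneq near => <-.
  by rewrite normr0 mulr0 -leNgt.
move: near ba; rewrite (gtr0_norm a0) => near ba.
have b0 : 0 < b.
  have := le_lt_trans (ler_norm _) near; nra.
have {}ba : b <= a by apply: le_trans ba; exact: ler_norm.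
have bge : (1 - eta) * a <= b.
  have := ltW (le_lt_trans (ler_norm _) near); nra.
rewrite -[leLHS]addr0 lerD//; last first.
  by rewrite !mulr_ge0// powR_ge0.
apply: (@le_trans _ _ ((P%:R * eta) ^+ 2 * (a `^ p))); last first.
  by rewrite ler_wpM2l ?sqr_ge0// lerDl.
rewrite -{2}(gtr0_norm a0) -(signed_powR_sqr _ p0) -exprMn /signed_powR.
rewrite !gtr0_sg// !mul1r !gtr0_norm//.
set q := p / 2; pose t := b / a.
have t0 : 0 < t by rewrite divr_gt0.
have t1 : t <= 1 by rewrite ler_pdivrMr ?mul1r.
have te : 1 - eta <= t by rewrite ler_pdivlMr.
have bE : b `^ q = t `^ q * a `^ q.
  by rewrite -powRM ?(ltW t0) ?(ltW a0)// /t divfK ?gt_eqF.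
have tq1 : t `^ q <= 1.
  have one : 1 `^ q = 1 :> R by rewrite powR1.
  by rewrite -[leRHS]one ge0_ler_powR ?nnegrE ?(ltW t0)// ltW.
(* As [t <= 1] and [p / 2 <= P], the real power dominates [t ^+ P], to which Bernoulli's inequality
   applies. *)
have tqP : 1 - P%:R * eta <= t `^ q.
  apply: (@le_trans _ _ (t ^+ P)).
    apply: le_trans (bernoulli_expr P _); last by rewrite (ltW t0).
    by rewrite lerD2l lerN2 ler_wpM2l//; lra.
  rewrite -powR_mulrn ?(ltW t0)// /powR gt_eqF// ler_expR.
  by rewrite ler_wnM2r ?ln_le0// /q; move: pP p0; lra.
have aq : 0 <= a `^ q by rewrite powR_ge0.
rewrite bE -[X in X - _]mul1r -mulrBl lerXn2r ?nnegrE ?mulr_ge0 ?subr_ge0//.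
  by rewrite ltW.
by rewrite ler_wpM2r//; lra.
Qed.

Lemma powR_normB_le p a b : 0 < p ->
  `|a - b| `^ p <= 2 `^ p * (`|a| `^ p + `|b| `^ p).
Proof.
move=> p0; wlog ba : a b / `|b| <= `|a|.
  move=> H; have [ba|/ltW ab] := leP `|b| `|a|; first exact: H.
  by rewrite distrC (addrC (`|a| `^ p)); exact: H.
apply: (@le_trans _ _ ((2 * `|a|) `^ p)).
  rewrite ge0_ler_powR ?nnegrE ?(ltW p0) ?mulr_ge0//.
  apply: le_trans (ler_normB _ _) _; rewrite mulr_natl mulr2n lerD2l//.
by rewrite powRM// ler_wpM2l ?powR_ge0// lerDl powR_ge0.
Qed.

End SignedPower.

Section PoincarePowR.
Variables (R : realType) (J H : finType) (c : H -> {ffun J -> bool}) (lam : R).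
Local Notation Q := {ffun J -> bool}.
Hypothesis lam01 : 0 < lam <= 1.
Hypothesis gap : forall w : Q, w != 0 ->
  lam * #|H|%:R <= #|[pred h | dot w (c h)]|%:R.

Variables (p : R) (P : nat).
Hypothesis pP : 0 < p <= P%:R.
Variable F : Q -> R.

Local Notation energy := (\sum_h \sum_(x : Q) `|F (x + c h) - F x| `^ p).

Let p0 : 0 < p. Proof. by case/andP: pP. Qed.

(* The L_2 inequality is applied to the image of [F - s] under the Mazur map; the
   median [s] makes the variance of this image comparable with its L_2 norm. *)
Lemma poincare_median (s : R) :
  (#|{: Q}| <= 2 * #|[pred x | (F x <= s)%R]|)%N ->
  (#|{: Q}| <= 2 * #|[pred x | (s <= F x)%R]|)%N ->
  lam * #|H|%:R * (\sum_x `|F x - s| `^ p) <=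
  16 * (8 * P%:R / lam) `^ p * energy.
Proof.
move=> sle sge; have [lam0 lam1] := andP lam01.
have P0 : 0 < P%:R :> R by case/andP: pP => /lt_le_trans; exact.
pose g x := signed_powR (p / 2) (F x - s).
have gE x : g x ^+ 2 = `|F x - s| `^ p by rewrite signed_powR_sqr.
pose S := \sum_x `|F x - s| `^ p; rewrite -/S.
have S0 : 0 <= S by apply: sumr_ge0 => x _; rewrite powR_ge0.
have Q0 : 0 < #|{: Q}|%:R :> R by rewrite ltr0n; apply/card_gt0P; exists 0.
pose V := \sum_(y : Q) \sum_(x : Q) (g (x + y) - g x) ^+ 2.
(* For each [x], at least half of the points lie on the other side of the median, and there [g]
   differs from [g x] by at least [|g x|]. *)
have SV : #|{: Q}|%:R * S <= 2 * V.
  rewrite /V exchange_big /S !mulr_sumr; apply: ler_sum => x _.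
  rewrite -gE (reindex_inj (can_inj (cube_addK x)))/=.
  under eq_bigr do rewrite [x + _]addrC cube_addK.
  have half (A : pred Q) : (#|{: Q}| <= 2 * #|A|)%N ->
     (forall y, A y -> g x ^+ 2 <= (g y - g x) ^+ 2) ->
     #|{: Q}|%:R * g x ^+ 2 <= 2 * \sum_i (g i - g x) ^+ 2.
    move=> cA hA; apply: (@le_trans _ _ (2 * (#|A|%:R * g x ^+ 2))).
      by rewrite mulrA ler_wpM2r ?sqr_ge0// -natrM ler_nat.
    rewrite ler_pM2l// mulr_natl -sumr_const [leRHS](bigID (mem A))/=.
    rewrite -[leLHS]addr0 lerD//; last by apply: sumr_ge0 => *; exact: sqr_ge0.
    by apply: ler_sum => y /hA.
  have [xs|/ltW xs] := leP (F x) s.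
    apply: (half _ sge) => y /= ys.
    have gx : g x <= 0 by apply: signed_powR_le0; rewrite subr_le0.
    have gy : 0 <= g y by apply: signed_powR_ge0; rewrite subr_ge0.
    nra.
  apply: (half _ sle) => y /= ys.
  have gx : 0 <= g x by apply: signed_powR_ge0; rewrite subr_ge0.
  have gy : g y <= 0 by apply: signed_powR_le0; rewrite subr_le0.
  nra.
have VE := poincare_sq gap (ltW lam0) g; rewrite -/V in VE.
(* With this [eta], the terms with factor [(P%:R * eta) ^+ 2] finally contribute [lam ^+ 2 / 16]
   times [#|H| * S], which the left side absorbs because [lam <= 1]. *)
pose eta := lam / (8 * P%:R).
have P1 : 1 <= P%:R :> R by rewrite ler1n -(ltr0n R).
have e0 : 0 < eta by rewrite divr_gt0// mulr_gt0.
have e1 : eta <= 1 by rewrite ler_pdivrMr ?mulr_gt0//; lra.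
have Pe : P%:R * eta = lam / 8.
  by rewrite /eta invfM mulrA mulrCA -mulrA mulrCA; field; rewrite gt_eqF.
pose K := 4 * (8 * P%:R / lam) `^ p.
have EK : \sum_h \sum_(x : Q) (g (x + c h) - g x) ^+ 2 <=
    (lam / 8) ^+ 2 * (2 * #|H|%:R * S) + K * energy.
  have -> : 2 * #|H|%:R * S = \sum_(h : H) \sum_(x : Q)
      (`|F (x + c h) - s| `^ p + `|F x - s| `^ p).
    rewrite (eq_bigr (fun=> 2 * S)) => [|h _].
      by rewrite sumr_const -mulr_natl; ring.
    rewrite big_split/= -/S (reindex_inj (can_inj (cube_addK (c h))))/=.
    under eq_bigr do rewrite cube_addK.
    by rewrite -/S; ring.
  rewrite !mulr_sumr -big_split; apply: ler_sum => h _.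
  rewrite !mulr_sumr -big_split; apply: ler_sum => x _ /=.
  have := signed_powR_diff (F (x + c h) - s) (F x - s) pP (eta := eta).
  rewrite e0 e1 Pe (_ : F (x + c h) - s - (F x - s) = F (x + c h) - F x);
    last ring.
  by rewrite /K /eta invf_div; apply.
have {}SV : lam * #|H|%:R * S <= 2 * (\sum_h \sum_(x : Q) (g (x + c h) - g x)
  ^+ 2).
  rewrite -(ler_pM2l Q0) mulrCA.
  apply: (@le_trans _ _ (lam * #|H|%:R * (2 * V))).
    by rewrite ler_wpM2l// mulr_ge0// ltW.
  by rewrite mulrCA [leRHS]mulrCA ler_pM2l.
have {}SV := le_trans SV (ler_wpM2l (ler0n _ 2) EK).
have -> : 16 * (8 * P%:R / lam) `^ p * energy = 4 * (K * energy).
  by rewrite /K; ring.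
have HS : 0 <= #|H|%:R * S by rewrite mulr_ge0.
have : 0 <= lam * (1 - lam) * (#|H|%:R * S).
  by rewrite mulr_ge0// mulr_ge0 ?subr_ge0// ltW.
have : 0 <= lam * (#|H|%:R * S) by rewrite mulr_ge0// ltW.
move: SV; rewrite -(mulrA lam) -(mulrA 2); set Z := K * _.
by move: (#|H|%:R * S) Z => W Z; nra.
Qed.

(** Each difference is split at the median [s], at the cost of a factor [2 ^ p], which turns 8 into
    16. Both resulting moments equal [S] by translation invariance, which turns the outer 16 into
    32. *)
Lemma poincare_powR :
  lam * #|H|%:R * \sum_(y : Q) \sum_(x : Q) `|F (x + y) - F x| `^ p <=
  32 * (16 * P%:R / lam) `^ p * #|{: Q}|%:R * energy.
Proof.
have [s [sle sge]] := finite_median F 0.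
have [lam0 lam1] := andP lam01.
set S := \sum_x `|F x - s| `^ p.
apply: (@le_trans _ _ (lam * #|H|%:R * (2 `^ p * (2 * #|{: Q}|%:R * S)))).
  rewrite ler_wpM2l//; first by rewrite mulr_ge0// ltW.
  have -> : 2 * #|{: Q}|%:R * S = \sum_(y : Q) \sum_(x : Q)
      (`|F (x + y) - s| `^ p + `|F x - s| `^ p).
    rewrite (eq_bigr (fun=> 2 * S)) => [|y _].
      by rewrite sumr_const -mulr_natl; ring.
    rewrite big_split/= -/S (reindex_inj (can_inj (cube_addK y)))/=.
    under eq_bigr do rewrite cube_addK.
    by rewrite -/S; ring.
  rewrite mulr_sumr; apply: ler_sum => y _.
  rewrite mulr_sumr; apply: ler_sum => x _.
  have -> : F (x + y) - F x = (F (x + y) - s) - (F x - s) by ring.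
  exact: powR_normB_le.
have -> : 16 * P%:R / lam = 2 * (8 * P%:R / lam) :> R by ring.
rewrite powRM// ?divr_ge0 ?mulr_ge0 ?(ltW lam0)//.
have := poincare_median sle sge; rewrite -/S; set E := energy.
set a := lam * _; set K := (_ `^ p); set b := (_ `^ p) => h.
rewrite (_ : a * _ = (2 * b * #|{: Q}|%:R) * (a * S)); last ring.
rewrite (_ : _ * E = (2 * b * #|{: Q}|%:R) * (16 * K * E)); last ring.
by rewrite ler_wpM2l// !mulr_ge0// powR_ge0.
Qed.

End PoincarePowR.

Local Open Scope classical_set_scope.
Local Open Scope ring_scope.

Lemma ge0_le_integral_sum d (T : measurableType d) (R : realType)
    (mu : {measure set T -> \bar R}) (I I' : finType)
    (w : I -> T -> R) (w' : I' -> T -> R) (a b : R) :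
  (forall i, measurable_fun setT (w i)) -> (forall i, measurable_fun setT (w'
    i)) ->
  (forall i t, 0 <= w i t) -> (forall i t, 0 <= w' i t) -> 0 <= a -> 0 <= b ->
  (forall t, a * \sum_i w i t <= b * \sum_i w' i t) ->
  (a%:E * \sum_i \int[mu]_t (w i t)%:E <= b%:E * \sum_i \int[mu]_t (w' i
    t)%:E)%E.
Proof.
move=> mw mw' w0 w'0 a0 b0 le.
have E (I0 : finType) (v : I0 -> T -> R) (k : R) :
    (forall i, measurable_fun setT (v i)) -> (forall i t, 0 <= v i t) -> 0 <= k
      ->
    (k%:E * \sum_i \int[mu]_t (v i t)%:E = \int[mu]_t (k * \sum_i v i t)%:E)%E.
  move=> mv v0 k0.
  rewrite -ge0_integral_sum//; last 2 first.
  - by move=> i; exact/measurable_EFinP.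
  - by move=> i t _; rewrite lee_fin.
  rewrite -ge0_integralZl//; last 2 first.
  - by apply: emeasurable_sum => i; exact/measurable_EFinP.
  - by move=> t _; apply: sume_ge0 => i _; rewrite lee_fin.
  by apply: eq_integral => t _; rewrite sumEFin EFinM.
rewrite !E//; apply: ge0_le_integral => //.
- by move=> t _; rewrite lee_fin mulr_ge0// sumr_ge0.
- by apply/measurable_EFinP/measurable_funM => //; exact: measurable_sum.
- by apply/measurable_EFinP/measurable_funM => //; exact: measurable_sum.
by move=> t _; rewrite lee_fin.
Qed.

Section LpPoincare.
Variables (R : realType) (p : R) (p1 : (1 <= p%:E)%E).

Let p0 : 0 < p. Proof. by rewrite (lt_le_trans ltr01)// -lee_fin. Qed.

Lemma Lp_dist_powR (u v : Lp p1) :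
  ((Lp_dist u v) `^ p = \int[lebesgue01 R]_t (`|u t - v t| `^ p)%:E)%E.
Proof. by rewrite /Lp_dist poweR_Lnorm ?gt_eqF//; apply: eq_integral. Qed.

Lemma measurable_powR_dist (u v : Lp p1) :
  measurable_fun setT (fun t => `|u t - v t| `^ p).
Proof.
apply: (@measurableT_comp _ _ _ _ _ _ (fun x => x `^ p)) => //.
have mfun_Lp (w : Lp p1) : measurable_fun setT (w : _ -> R).
  exact: (@measurable_funPT _ _ _ _
    (repr (w : {mfun_ lebesgue01 R, _ >-> measurableTypeR R}))).
by apply: measurableT_comp => //; apply: measurable_funB; exact: mfun_Lp.
Qed.

(** The p-th power of the distance is an integral, so the scalar inequality for [x] mapped to
    [psi x t] can be integrated over [t]. *)
Lemma poincare_Lp (J H : finType) (c : H -> {ffun J -> bool}) (lam : R) (P :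
  nat)
    (psi : {ffun J -> bool} -> Lp p1) :
  0 < lam <= 1 ->
  (forall w, w != 0 -> lam * #|H|%:R <= #|[pred h | dot w (c h)]|%:R) ->
  p <= P%:R ->
  ((lam * #|H|%:R)%:E * \sum_(y : {ffun J -> bool}) \sum_(x : {ffun J -> bool})
    (Lp_dist (psi (x + y)%R) (psi x)) `^ p <=
   (32 * (16 * P%:R / lam) `^ p * #|{: {ffun J -> bool}}|%:R)%:E *
     \sum_h \sum_(x : {ffun J -> bool}) (Lp_dist (psi (x + c h)%R) (psi x)) `^
       p)%E.
Proof.
move=> lam01 gap pP; have [lam0 _] := andP lam01.
rewrite !pair_big/=.
under eq_bigr do rewrite Lp_dist_powR.
under [in leRHS]eq_bigr do rewrite Lp_dist_powR.
apply: ge0_le_integral_sum => [yx|hx|yx t|hx t|||t].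
- exact: measurable_powR_dist.
- exact: measurable_powR_dist.
- exact: powR_ge0.
- exact: powR_ge0.
- by rewrite mulr_ge0// ltW.
- by rewrite !mulr_ge0// powR_ge0.
have := poincare_powR lam01 gap (p := p) (P := P) _ (fun x => psi x t).
by rewrite p0 pP !pair_big; exact.
Qed.

End LpPoincare.

(** * Permutation groups and generated subgroups *)

Section Bijections.
Variable T : Type.

Record bijection := Bijection {
  bfun :> T -> T;
  binv : T -> T;
  bfunK : cancel bfun binv;
  binvK : cancel binv bfun }.

Lemma bijection_eq (f g : bijection) : f =1 g -> f = g.
Proof.
case: f g => [f f' fK f'K] [g g' gK g'K] /= /funext fg.
subst g; have fg' : f' = g'.
  by apply/funext => x; rewrite -{1}(g'K x) fK.
by subst g'; rewrite (Prop_irrelevance fK gK) (Prop_irrelevance f'K g'K).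
Qed.

HB.instance Definition _ := gen_eqMixin bijection.
HB.instance Definition _ := gen_choiceMixin bijection.

Definition bijection_one := @Bijection id id (fun=> erefl) (fun=> erefl).
Definition bijection_inv (f : bijection) := Bijection (@binvK f) (@bfunK f).
Definition bijection_mul (f g : bijection) :=
  Bijection (can_comp (@bfunK f) (@bfunK g)) (can_comp (@binvK g) (@binvK f)).

Lemma bijection_mulA : associative bijection_mul.
Proof. by move=> f g h; exact: bijection_eq. Qed.
Lemma bijection_mul1 : left_id bijection_one bijection_mul.
Proof. by move=> f; exact: bijection_eq. Qed.
Lemma bijection_mulr1 : right_id bijection_one bijection_mul.
Proof. by move=> f; exact: bijection_eq. Qed.
Lemma bijection_mulV : left_inverse bijection_one bijection_inv bijection_mul.
Proof. by move=> f; apply: bijection_eq => x /=; rewrite bfunK. Qed.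
Lemma bijection_mulrV : right_inverse bijection_one bijection_inv bijection_mul.
Proof. by move=> f; apply: bijection_eq => x /=; rewrite binvK. Qed.

HB.instance Definition _ := isGroup.Build bijection
  bijection_mulA bijection_mul1 bijection_mulr1 bijection_mulV bijection_mulrV.

End Bijections.

Section Generated.
Variable Gr : groupType.
Implicit Types (S : set Gr) (g h : Gr).

Lemma smallest_subgroup S : subgroup (smallest (@subgroup Gr) S).
Proof.
split=> [H [[]]//|g h gS hS H HS|g gS H HS]; have [_ HM HV] := HS.1.
  by apply: HM; [exact: gS|exact: hS].
by apply: HV; exact: gS.
Qed.

Lemma generates_ind S (H : set Gr) : generates S -> subgroup H -> S `<=` H ->
  forall g, H g.
Proof.
by move=> gS sH SH g; have : setT g by []; rewrite -gS; apply; split.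
Qed.

Variable S : set Gr.

Record generated := Generated {
  gval :> Gr;
  gvalP : smallest (@subgroup Gr) S gval }.

Lemma gval_inj : injective gval.
Proof.
by case=> f fP [g gP] /= fg; subst g; rewrite (Prop_irrelevance fP gP).
Qed.

HB.instance Definition _ := gen_eqMixin generated.
HB.instance Definition _ := gen_choiceMixin generated.

Let sub1 : smallest (@subgroup Gr) S 1%g.
Proof. by have [] := smallest_subgroup S. Qed.
Let subM g h : smallest (@subgroup Gr) S g -> smallest (@subgroup Gr) S h ->
  smallest (@subgroup Gr) S (g * h)%g.
Proof. by have [_ + _] := smallest_subgroup S; exact. Qed.
Let subV g : smallest (@subgroup Gr) S g -> smallest (@subgroup Gr) S g^-1%g.
Proof. by have [_ _] := smallest_subgroup S; exact. Qed.

Definition generated_one := Generated sub1.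
Definition generated_mul (f g : generated) := Generated (subM (gvalP f) (gvalP
  g)).
Definition generated_inv (f : generated) := Generated (subV (gvalP f)).

Lemma generated_mulA : associative generated_mul.
Proof. by move=> f g h; apply: gval_inj => /=; rewrite mulgA. Qed.
Lemma generated_mul1 : left_id generated_one generated_mul.
Proof. by move=> f; apply: gval_inj => /=; rewrite mul1g. Qed.
Lemma generated_mulr1 : right_id generated_one generated_mul.
Proof. by move=> f; apply: gval_inj => /=; rewrite mulg1. Qed.
Lemma generated_mulV : left_inverse generated_one generated_inv generated_mul.
Proof. by move=> f; apply: gval_inj => /=; rewrite mulVg. Qed.
Lemma generated_mulrV : right_inverse generated_one generated_inv generated_mul.
Proof. by move=> f; apply: gval_inj => /=; rewrite mulgV. Qed.

HB.instance Definition _ := isGroup.Build generated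
  generated_mulA generated_mul1 generated_mulr1 generated_mulV generated_mulrV.

Lemma gvalM (f g : generated) : gval (f * g)%g = (gval f * gval g)%g.
Proof. by []. Qed.

(** The image in [Gr] of a subgroup containing these generators is a subgroup containing [S], hence
    contains every [gval g]. *)
Lemma generates_generated : generates [set g : generated | S (gval g)].
Proof.
rewrite /generates -subTset => g _ H [[H1 HM HV] SH].
pose K : set Gr := [set x | exists h : generated, H h /\ gval h = x].
suff : K (gval g) by move=> [h [Hh /gval_inj <-]].
apply: (gvalP g); split=> [|x Sx].
  split; first by exists 1%g.
    move=> _ _ [f [Hf <-]] [h [Hh <-]]; exists (f * h)%g; split=> //.
    exact: HM.
  by move=> _ [f [Hf <-]]; exists f^-1%g; split=> //; exact: HV.
exists (Generated (sub_gen_smallest Sx)); split=> //; exact: SH.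
Qed.

Lemma finitely_generated_generated : finite_set S -> finitely_generated
  generated.
Proof.
move=> finS; exists [set g : generated | S (gval g)]; split.
  apply: finite_preimage finS; move=> x y _ _; exact: gval_inj.
exact: generates_generated.
Qed.

End Generated.

(** * Amenability *)

Lemma ultra_fmap (T V : Type) (U : set_system T) (f : T -> V) :
  UltraFilter U -> UltraFilter (f @ U).
Proof.
move=> UU; split; first exact: fmap_proper_filter.
move=> G PG sub; rewrite predeqE => A; split; last exact: sub.
move=> GA; have [//|UnA] := in_ultra_setVsetC (f @^-1` A) UU.
have GnA : G (~` A) by apply: sub.
by have [x []] := filter_ex (filterI GA GnA).
Qed.

Lemma ultra_bounded_cvg (R : realType) (T : Type) (U : set_system T)
    (f : T -> R) a b : UltraFilter U -> (forall x, a <= f x <= b) ->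
  cvg (f @ U).
Proof.
move=> UU fab; have := @segment_compact R a b; rewrite compact_ultra.
move=> /(_ (f @ U) (ultra_fmap f UU)) []; last by move=> l [_ fl];
  apply: cvgP fl.
have PU : ProperFilter U by exact: ultra_proper.
by apply: (@filterE _ U) => x; rewrite /= in_itv; exact: fab.
Qed.

Section AmenabilityCriteria.
Variables (R : realType) (G : groupType).

(** Limits along an ultrafilter finer than [\oo] exist for all bounded sequences and turn asymptotic
    invariance into invariance. The elements that leave the limit invariant form a subgroup, so
    checking [S] suffices. *)
Lemma amenable_almost_invariant (S : set G) (m : nat -> set G -> R) :
  generates S ->
  (forall n A, 0 <= m n A) -> (forall n, m n setT = 1) ->
  (forall n A B, A `&` B = set0 -> m n (A `|` B) = m n A + m n B) ->
  (forall g A, S g -> m n [set (g * x)%g | x in A] - m n A @[n --> \oo] --> 0)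
    ->
  amenable R G.
Proof.
move=> gS m0 m1 mD minv; have [U [UU ooU]] := ultraFilterLemma
  eventually_filter.
have mU A : cvg (m ^~ A @ U).
  apply: (@ultra_bounded_cvg _ _ _ _ 0 1 UU) => n; rewrite m0 -(m1 n).
  by rewrite -(setUv A) mD ?setICr// lerDl m0.
have PU : ProperFilter U by exact: ultra_proper.
exists (fun A => lim (m ^~ A @ U)); split.
- by move=> A; apply: limr_ge => //; apply: nearW => n; exact: m0.
- by apply: cvg_lim => //; rewrite (_ : m ^~ setT = cst 1) ?funeqE//;
  exact: cvg_cst.
- move=> A B AB; rewrite -limD//; congr (lim (_ @ U)).
  by apply/funext => n; rewrite mD.
suff : forall g, (fun g => forall A, lim (m ^~ [set (g * x)%g | x in A] @ U)
    = lim (m ^~ A @ U)) g by [].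
have t1 A : [set (1 * x)%g | x in A] = A :> set G.
  by rewrite -[RHS]image_id; apply: eq_imagel => x _; rewrite mul1g.
have tM g h A : [set (g * h * x)%g | x in A] =
    [set (g * y)%g | y in [set (h * x)%g | x in A]] :> set G.
  by rewrite image_comp; apply: eq_imagel => x _ /=; rewrite mulgA.
apply: (generates_ind gS) => [|g Sg A]; first split.
- by move=> A; rewrite t1.
- by move=> g h Hg Hh A; rewrite tM Hg Hh.
- by move=> g Hg A; rewrite -Hg -tM mulgV t1.
apply: cvg_lim => //; apply: cvg_sub0 (mU A).
by apply: cvg_trans (minv g A Sg) => V; exact: ooU.
Qed.

(* The mean is a limit of averages over the products [s ^+ i * k] with [i <= n]
   and [k \in K]; these averages are invariant under [S], and translation by [s]
   changes only the terms at both ends of the range of [i]. *)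
Lemma amenable_cyclic_extension (s : G) (S : set G) :
  generates (s |` S) ->
  (forall n, exists K : seq G, [/\ uniq K, K != [::] &
    forall i t k, (i <= n)%N -> S t -> k \in K ->
      ((s ^- i * t * s ^+ i) * k)%g \in K]) ->
  amenable R G.
Proof.
move=> gS /choice[K KP].
pose N n i (A : set G) : R := \sum_(k <- K n) (`[< A (s ^+ i * k)%g >])%:R.
pose m n A := (\sum_(i < n.+1) N n i A) / (n.+1 * size (K n))%:R.
have K0 n : (0 < size (K n))%N by case: (KP n) => _; case: (K n).
have c0 n : 0 < (n.+1 * size (K n))%:R :> R by rewrite ltr0n muln_gt0/=.
have Nge0 n i A : 0 <= N n i A by apply: sumr_ge0.
have NleK n i A : N n i A <= (size (K n))%:R.
  by rewrite /N -sum1_size natr_sum ler_sum// => k _; case: asboolP.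
apply: (@amenable_almost_invariant _ m gS).
- by move=> n A; rewrite divr_ge0//; exact: sumr_ge0.
- move=> n; rewrite /m (eq_bigr (fun=> (size (K n))%:R)) => [|i _].
    by rewrite sumr_const card_ord -mulrnA mulnC divff ?gt_eqF.
  by rewrite /N -sum1_size natr_sum; apply: eq_bigr => k _;
    case: asboolP => // -[].
- move=> n A B AB; rewrite /m -mulrDl -big_split/=; congr (_ / _).
  apply: eq_bigr => i _; rewrite /N -big_split/=; apply: eq_bigr => k _.
  have : ~ (A (s ^+ i * k)%g /\ B (s ^+ i * k)%g).
    by move=> AB'; have : (A `&` B) (s ^+ i * k)%g by []; rewrite AB.
  case: asboolP => [[a|b]|/not_orP[a b]]; case: asboolP => //;
    case: asboolP => //;
    rewrite ?addr0 ?add0r//; tauto.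
have imgE g (A : set G) x : [set (g * y)%g | y in A] (g * x)%g = A x.
  by apply/propext; split=> [[y Ay /mulgI <-]|Ax]//; exists x.
move=> g A [->|Sg].
  suff bound n : `|m n [set (s * x)%g | x in A] - m n A| <= n.+1%:R^-1.
    apply: norm_cvg0; apply: (@squeeze_cvgr _ _ _ _ (cst 0) (@harmonic R)).
    - by apply: nearW => n; rewrite normr_ge0 bound.
    - exact: cvg_cst.
    - exact: cvg_harmonic.
  (* Translation by [s] shifts the index [i] by one: the two sums differ by one end term each, and
     each of these is at most the size of [K n]. *)
  have NS i : N n i.+1 [set (s * x)%g | x in A] = N n i A.
    by apply: eq_bigr => k _; rewrite expgS -mulgA imgE.
  rewrite /m -mulrBl big_ord_recl [X in _ - X]big_ord_recr/=.
  rewrite (eq_bigr (fun i : 'I_n => N n i A)); last by move=> i _; rewrite NS.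
  rewrite opprD addrA addrK normrM normfV (gtr0_norm (c0 n)).
  rewrite ler_pdivrMr// natrM mulrA mulVf ?pnatr_eq0// mul1r.
  rewrite ler_norml.
  have := Nge0 n 0%N [set (s * x)%g | x in A]; have := Nge0 n n A.
  have := NleK n 0%N [set (s * x)%g | x in A]; have := NleK n n A.
  by move=> *; apply/andP; split; lra.
rewrite (_ : (fun n => _) = cst 0); first exact: cvg_cst.
apply/funext => n; apply/eqP; rewrite subr_eq0; apply/eqP.
rewrite /m; congr (_ / _); apply: eq_bigr => i _.
have [uK _ KS] := KP n.
pose u := (s ^- i * g * s ^+ i)%g.
(* Left multiplication by [u] permutes [K n], and [s ^+ i * u = g * s ^+ i], so reindexing by it
   removes the translation by [g]. *)
have Ku : perm_eq (map (fun k => u * k)%g (K n)) (K n).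
  have uu : uniq (map (fun k => u * k)%g (K n)).
    by rewrite map_inj_uniq// => x y /mulgI.
  have [|_ eqK] := uniq_min_size uu _ (eq_leq (esym (size_map _ _))).
    by move=> _ /mapP[k kK ->]; apply: KS => //; rewrite -ltnS.
  exact: uniq_perm.
rewrite /N -(perm_big _ Ku)/= big_map; apply: eq_bigr => k _.
rewrite /u !mulgA mulgV mul1g -!mulgA.
by have /= -> := imgE g A (s ^+ i * k)%g.
Qed.

End AmenabilityCriteria.

(** * The lamp group *)

(** [D] consists of the sums of sublists of an enumeration of [A]. Adjoining [v] adds the translate
    of [D] by [v], and the result is stable under [v] because [v + v = 0]. *)
Lemma exponent2_span (V : zmodType) (A : set V) : (forall v : V, v + v = 0) ->
  finite_set A ->
  exists D : set V, [/\ finite_set D, D 0 & forall v d, A v -> D d -> D (d +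
    v)].
Proof.
move=> vv /finite_seqP[l ->] /=; elim: l => [|v l [D [fD D0 Dl]]].
  by exists [set 0]; split=> //; exact: finite_set1.
exists (D `|` [set d + v | d in D]); split.
- by rewrite finite_setU; split=> //; exact: finite_image.
- by left.
move=> w d; rewrite inE => /predU1P[->|wl] [Dd|[e De <-]].
- by right; exists d.
- by left; rewrite -addrA vv addr0.
- by left; exact: Dl.
- by right; exists (e + w); [exact: Dl|rewrite addrAC].
Qed.

(** Equivalent to finiteness of the monoid generated by the maps [f i], in a form that avoids
    words. *)
Definition finitely_closed (Y : Type) (I : finType) (f : I -> Y -> Y) : Prop :=
  exists K : set (Y -> Y), [/\ finite_set K, K id &
    forall i k, K k -> K (f i \o k)].

Lemma finitely_closed_translations (V : zmodType) (I : finType) (u : I -> V) :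
  (forall v : V, v + v = 0) -> finitely_closed (fun i x => x + u i).
Proof.
move=> vv; have [D [fD D0 Du]] := exponent2_span vv (finite_image u
  (@finite_finset I setT)).
exists [set (fun x => x + d) | d in D]; split.
- exact: finite_image.
- by exists 0 => //; apply/funext => x; rewrite addr0.
move=> i _ [d Dd <-]; exists (d + u i); first by apply: Du => //; exists i.
by apply/funext => x /=; rewrite addrA.
Qed.

Definition skew (Y : Type) (V : zmodType) (s : Y -> Y) (d : Y -> V) (z : Y * V)
  :=
  (s z.1, z.2 + d z.1).

(** Every composite is [skew k e] with [k] in [K] and [e] a sum of functions [d i] composed with
    members of [K]. These functions are finite in number and span a finite group, since the fibre
    has exponent 2. *)
Lemma finitely_closed_skew (Y : Type) (V : zmodType) (I : finType)
    (s : I -> Y -> Y) (d : I -> Y -> V) : (forall v : V, v + v = 0) ->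
  finitely_closed s -> finitely_closed (fun i => skew (s i) (d i)).
Proof.
move=> vv [K [fK K1 Ks]].
have ww (w : Y -> V) : w + w = 0 by apply/funext => y; exact: vv.
have [D [fD D0 Dl]] := exponent2_span ww
  (finite_image2 (fun i (k : Y -> Y) => d i \o k) (@finite_finset I setT) fK).
exists [set skew k.1 k.2 | k in K `*` D]; split.
- exact/finite_image/finite_setX.
- by exists (id, 0) => //; apply/funext => -[y v]; rewrite /skew/= addr0.
move=> i _ [[k e] [/= Kk De] <-]; exists (s i \o k, e + (d i \o k)).
  split=> /=; first exact: Ks.
  by apply: Dl => //; exists i => //; exists k.
by apply/funext => -[y v]; rewrite /skew/= addrA.
Qed.

(** * The space acted upon and the generators *)

Definition lamps : zmodType := int -> bool.
(** The first index is a stage, the second the code of a set of variables of that stage, so one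
    space serves all stages. *)
Definition fibre : zmodType := nat -> nat -> bool.
Definition space : Type := ((lamps * bool) * fibre)%type.

Lemma lamps_addxx (x : lamps) : x + x = 0.
Proof. by apply/funext => k; exact: addbb. Qed.

Lemma fibre_addxx (b : fibre) : b + b = 0.
Proof. by apply/funext => r; apply/funext => k; exact: addbb. Qed.

(** Common form of the three involutive generators and, by [layer_shift], of their conjugates by
    powers of the shift. *)
Definition layer (u : lamps) (d1 : lamps -> bool) (d2 : lamps * bool -> fibre) :
  space -> space := skew (skew (fun x => x + u) d1) d2.

Lemma finitely_closed_layers (I : finType) u d1 d2 :
  finitely_closed (fun i : I => layer (u i) (d1 i) (d2 i)).
Proof.
apply: finitely_closed_skew fibre_addxx _.
apply: finitely_closed_skew addbb _.
exact: finitely_closed_translations lamps_addxx.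
Qed.

Lemma layer_involutive u d1 d2 : (forall x, d1 (x + u) = d1 x) ->
  (forall x beta, d2 (x + u, beta + d1 x) = d2 (x, beta)) ->
  involutive (layer u d1 d2).
Proof.
move=> h1 h2 [[x beta] b]; rewrite /layer /skew /= h1 h2 -!addrA.
by rewrite lamps_addxx fibre_addxx [d1 x + _]addbb !addr0.
Qed.

Definition shift (j : int) (x : lamps) : lamps := fun k => x (k + j).

Definition shift_space (j : int) (z : space) : space :=
  ((shift j z.1.1, z.1.2), z.2).

Lemma shiftD i j x : shift i (shift j x) = shift (i + j) x.
Proof. by apply/funext => k; rewrite /shift -addrA. Qed.

Lemma shift0 x : shift 0 x = x.
Proof. by apply/funext => k; rewrite /shift addr0. Qed.

Lemma shift_spaceK j : cancel (shift_space j) (shift_space (- j)).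
Proof. by case=> [[x beta] b]; rewrite /shift_space/= shiftD addNr shift0. Qed.

Lemma shift_spaceNK j : cancel (shift_space (- j)) (shift_space j).
Proof. by case=> [[x beta] b]; rewrite /shift_space/= shiftD subrr shift0. Qed.

Lemma layer_shift j u d1 d2 z :
  shift_space (- j) (layer u d1 d2 (shift_space j z)) =
  layer (shift (- j) u) (d1 \o shift j)
    (d2 \o (fun y => (shift j y.1, y.2))) z.
Proof.
case: z => [[x beta] b]; rewrite /layer /skew /shift_space/=.
congr (_, _, _); apply/funext => k.
by rewrite -[LHS]/(x (k - j + j) + u (k - j)) subrK.
Qed.

Definition nvars r := (r * 2 ^ r)%N.
Local Notation J r := (rset (nvars r) r).
Local Notation Q r := {ffun J r -> bool}.

(* Lamp [2 r + 1] selects the stage [r], and the lamps [2 i] carry the values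
   of the variables [i < nvars r] of that stage. *)
Definition color (x : lamps) : fibre := fun r k =>
  x (2 * r + 1)%N &&
  (if unpickle k is Some A then
     [forall i, (i \in sval (A : J r)) ==> x (2 * i)%N] else false).

Definition delta (k : int) : lamps := fun j => j == k.

Definition shift_bij : bijection space :=
  Bijection (shift_spaceK 1) (shift_spaceNK 1).

Definition flip_bij : bijection space :=
  let inv := @layer_involutive (delta 0) (cst 0) (cst 0)
    (fun=> erefl) (fun _ _ => erefl) in Bijection inv inv.

Lemma swap_involutive : involutive (layer 0 (fun x => `[< x = 0 >]) (cst 0)).
Proof. by apply: layer_involutive => // x; rewrite addr0. Qed.

Definition swap_bij : bijection space := Bijection swap_involutive
  swap_involutive.

Lemma fibre_layer_involutive d2 : involutive (layer 0 (cst 0) d2).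
Proof. by apply: layer_involutive => // x beta; rewrite /cst !addr0. Qed.

Definition fibre_bij d2 : bijection space :=
  Bijection (fibre_layer_involutive d2) (fibre_layer_involutive d2).

Definition paint_bij := fibre_bij (fun y => if y.2 then color y.1 else 0).

Definition central (v : fibre) := fibre_bij (fun y => if `[< y.1 = 0 >] then v
  else 0).

Definition involutive_gens : set (bijection space) :=
  [set flip_bij; swap_bij; paint_bij].

Definition lamp_gens := shift_bij |` involutive_gens.

Definition lamp_group := generated lamp_gens.
HB.instance Definition _ := Group.on lamp_group.

Definition shift_elt : lamp_group := Generated (sub_gen_smallest (or_introl
  erefl : lamp_gens shift_bij)).
Definition flip_elt : lamp_group :=
  Generated (sub_gen_smallest
    (or_intror (or_introl (or_introl erefl)) : lamp_gens flip_bij)).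
Definition swap_elt : lamp_group :=
  Generated (sub_gen_smallest
    (or_intror (or_introl (or_intror erefl)) : lamp_gens swap_bij)).
Definition paint_elt : lamp_group :=
  Generated (sub_gen_smallest
    (or_intror (or_intror erefl) : lamp_gens paint_bij)).

Lemma finitely_generated_lamp_group : finitely_generated lamp_group.
Proof.
apply: finitely_generated_generated; rewrite /lamp_gens /involutive_gens.
by rewrite !finite_setU; do !split; exact: finite_set1.
Qed.

Definition action (g : lamp_group) : space -> space := bfun (gval g).

Lemma action_inj : injective action.
Proof. by move=> g h gh; apply/gval_inj/bijection_eq => z;
  rewrite -/(action _) gh. Qed.

Lemma actionM g h z : action (g * h)%g z = action g (action h z).
Proof. by []. Qed.

Lemma actionVK g z : action g^-1%g (action g z) = z.
Proof. by rewrite -actionM mulVg. Qed.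

Lemma action_sX n z : action (shift_elt ^+ n)%g z = shift_space n z.
Proof.
elim: n z => [|n IH] z.
  by case: z => [[x b] v]; rewrite /shift_space/= shift0.
rewrite expgS actionM IH; case: z => [[x b] v].
by rewrite /action /= /shift_space/= shiftD -PoszD add1n.
Qed.

Lemma action_sXV n z : action (shift_elt ^- n)%g z = shift_space (- n%:Z) z.
Proof. by rewrite -{1}(shift_spaceNK n z) -action_sX actionVK. Qed.

(** The defaults of [nth] matter: past the end of a list they supply the trivial translation or
    cocycle. *)
Lemma involutive_gens_layer t : involutive_gens t ->
  exists j : 'I_3, bfun t = layer (nth 0 [:: delta 0] j)
    (nth (cst 0) [:: cst 0; fun x => `[< x = 0 >]] j)
    (nth (cst 0) [:: cst 0; cst 0; fun y => if y.2 then color y.1 else 0] j).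
Proof.
move=> [[->|->]|->]; [by exists ord0| |by exists ord_max].
by exists (@Ordinal 3 1 isT).
Qed.

Lemma amenable_lamp_group (R : realType) : amenable R lamp_group.
Proof.
pose S : set lamp_group := [set g | involutive_gens (gval g)].
apply: (@amenable_cyclic_extension R lamp_group shift_elt S).
  rewrite (_ : _ |` _ = [set g : lamp_group | lamp_gens (gval g)]).
    exact: generates_generated.
  rewrite predeqE => g; split=> [[->|]|[gs|]]; [by left|by right| |by right].
  by left; exact: gval_inj.
(* [par] lists the actions of the conjugates of the three involutions by the powers of the shift up
   to [n]. The finite set closed under them is then pulled back to the group along the injective
   [action]. *)
move=> n; pose par (ij : 'I_n.+1 * 'I_3) := layer
   (shift (- ij.1%:Z) (nth 0 [:: delta 0] ij.2))
   (nth (cst 0) [:: cst 0; fun x => `[< x = 0 >]] ij.2 \o shift ij.1)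
   (nth (cst 0) [:: cst 0; cst 0; fun y => if y.2 then color y.1 else 0] ij.2 \o
     (fun y => (shift ij.1 y.1, y.2))).
have [K [fK K1 Kp]] : finitely_closed par by exact: finitely_closed_layers.
have /finite_seqP[l lE] : finite_set [set g : lamp_group | K (action g)].
  by apply: finite_preimage fK => x y _ _; exact: action_inj.
have memK g : (g \in undup l) <-> K (action g).
  by rewrite mem_undup; have := congr1 (@^~ g) lE => /= <-.
exists (undup l); split; first exact: undup_uniq.
  have : 1%g \in undup l by apply/memK.
  by case: undup.
move=> i t k ilen /involutive_gens_layer[j tE] /memK Kk; apply/memK.
suff -> : action (shift_elt ^- i * t * shift_elt ^+ i * k)%g =
    par (@Ordinal n.+1 i ilen, j) \o action k by exact: Kp.
apply/funext => z; rewrite !actionM action_sXV action_sX.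
rewrite -[action t _]/(bfun (gval t) _) tE layer_shift.
by [].
Qed.

(** * Words translating the fibre above the dark configuration *)

Section Words.

Definition flip_at (k : nat) : lamp_group := (shift_elt ^- k * flip_elt *
  shift_elt ^+ k)%g.

Definition flips (l : seq nat) : lamp_group := (\prod_(k <- l) flip_at k)%g.

Definition lamps_of (l : seq nat) : lamps := \sum_(k <- l) delta k%:Z.

Lemma action_flip_at k z : action (flip_at k) z = layer (delta k) (cst 0) (cst
  0) z.
Proof.
rewrite /flip_at !actionM action_sXV action_sX [action flip_elt]/(layer _ _ _).
rewrite layer_shift; congr layer; apply/funext => j.
by rewrite /shift /delta subr_eq0.
Qed.

Lemma layer0D u v z : layer u (cst 0) (cst 0) (layer v (cst 0) (cst 0) z) =
  layer (v + u) (cst 0) (cst 0) z.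
Proof. by case: z => [[x b] w]; rewrite /layer /skew/= addrA !addr0. Qed.

Lemma action_flips l z : action (flips l) z = layer (lamps_of l) (cst 0) (cst
  0) z.
Proof.
elim: l z => [|k l IH] z.
  rewrite /flips /lamps_of !big_nil; case: z => [[x b] w].
  by rewrite /layer /skew/= !addr0.
rewrite /flips /lamps_of !big_cons actionM -/(flips l) IH action_flip_at
  layer0D.
by rewrite addrC.
Qed.

Lemma lamps_ofE l (j : nat) : uniq l -> lamps_of l j = (j \in l).
Proof.
elim: l => [|k l IH] /=; first by rewrite /lamps_of big_nil.
move=> /andP[kl ul]; rewrite /lamps_of big_cons -/(lamps_of l).
rewrite -[LHS]/(delta k j + lamps_of l j) IH// inE /delta eqz_nat.
by case: eqVneq => [->|_]; rewrite ?(negbTE kl)//; case: (_ \in _).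
Qed.

(** [swap_elt] and the conjugate [p] of [paint_elt] are involutions, so this product is their
    commutator. *)
Definition central_word (l : seq nat) : lamp_group :=
  let p := ((flips l)^-1 * paint_elt * flips l)%g in (swap_elt * p * swap_elt *
    p)%g.

Lemma action_fibre d2 z : fibre_bij d2 z = (z.1, z.2 + d2 z.1).
Proof. by case: z => [[x b] w]; rewrite /= /layer /skew/= !addr0. Qed.

Lemma action_paint z :
  action paint_elt z = (z.1, z.2 + (if z.1.2 then color z.1.1 else 0)).
Proof. exact: action_fibre. Qed.

Lemma central_wordE l : gval (central_word l) = central (color (lamps_of l)).
Proof.
set u := lamps_of l; pose p := ((flips l)^-1 * paint_elt * flips l)%g.
have pE z : action p z =
    fibre_bij (fun y => if y.2 then color (y.1 + u) else 0) z.
  rewrite /p !actionM; set w := RHS.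
  have -> : action paint_elt (action (flips l) z) = action (flips l) w.
    rewrite !action_flips action_paint.
    rewrite /w action_fibre -/u; case: z {w} => [[x b] v].
    by rewrite /layer /skew/= !addr0.
  by rewrite actionVK.
rewrite (_ : central_word l = swap_elt * p * swap_elt * p)%g//; clearbody p.
apply: bijection_eq => z.
rewrite -/(action (swap_elt * p * swap_elt * p)%g z) !actionM !pE.
rewrite /central !action_fibre; case: z => [[x b] v].
rewrite /action /= /layer /skew /cst/= !addr0.
(* Away from the dark configuration the swap is trivial and the two translations by [p] cancel.
   Above it, each sheet is the upper one for exactly one of the two, so the color is added once. *)
case: asboolP => [->|_] /=; last first.
  by rewrite !addr0; case: b; rewrite ?addr0// -addrA fibre_addxx addr0.
rewrite add0r -addrA [true + true]addbb addr0; congr (_, _, _).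
by case: b; rewrite /= ?addr0 ?add0r.
Qed.

End Words.


(** * The Boolean cubes inside the group *)

Definition stage (r : nat) (q : Q r) : fibre := fun r' k =>
  (r' == r) && (if unpickle k is Some A then q A else false).

Lemma stageD r q q' : @stage r (q + q') = stage q + stage q'.
Proof.
apply/funext => r'; apply/funext => k.
rewrite -[RHS]/(stage q r' k + stage q' r' k) /stage.
by case: eqP => //= _; case: unpickle => //= A; rewrite ffunE.
Qed.

Lemma stage0 r : @stage r 0 = 0.
Proof.
apply/funext => r'; apply/funext => k; rewrite /stage.
by case: unpickle => [A|]; rewrite ?ffunE ?andbF.
Qed.

Lemma stage_inj r : injective (@stage r).
Proof.
move=> q q' /(congr1 (fun v : fibre => v r)) qq'; apply/ffunP => A.
by have := congr1 (@^~ (pickle A)) qq'; rewrite /stage eqxx pickleK.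
Qed.

Definition stage_lamps r (h : {set 'I_(nvars r)}) : seq nat :=
  (2 * r + 1)%N :: [seq (2 * val i)%N | i <- enum h].

Lemma stage_lamps_uniq r h : uniq (@stage_lamps r h).
Proof.
rewrite /= map_inj_uniq ?enum_uniq ?andbT.
  by apply/negP => /mapP[i _]; lia.
by move=> i j ij; apply: val_inj => /=; lia.
Qed.

(** Lamp [2 * r + 1] is the only odd lamp lit, so [color] vanishes outside row [r]; in that row the
    even lamps test inclusion in [h]. *)
Lemma color_stage_lamps r (h : {set 'I_(nvars r)}) :
  color (lamps_of (stage_lamps h)) = stage (monomials r h).
Proof.
apply/funext => r'; apply/funext => k; rewrite /color /stage.
rewrite !lamps_ofE ?stage_lamps_uniq// inE.
have -> : ((2 * r' + 1)%N \in [seq (2 * val i)%N | i <- enum h]) = false.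
  by apply/negP => /mapP[i _]; lia.
rewrite orbF eqn_add2r eqn_pmul2l//; case: eqP => //= ->.
case: unpickle => //= A; rewrite ffunE;
  apply/forall_inP/fintype.subsetP => Ah i iA.
  have := Ah i iA; rewrite lamps_ofE ?stage_lamps_uniq// inE.
  case: eqP => [|_ /=]; first by lia.
  by move=> /mapP[j]; rewrite mem_enum => jh ij; rewrite (_ : i = j)//;
    apply: val_inj => /=; lia.
rewrite lamps_ofE ?stage_lamps_uniq// inE; apply/orP; right.
by apply/mapP; exists i; rewrite ?mem_enum// Ah.
Qed.

Lemma centralD v w : (central v * central w)%g = central (v + w).
Proof.
apply: bijection_eq => z; rewrite -[LHS]/(central v (central w z))
  !action_fibre.
by rewrite /=; case: asboolP => _; rewrite ?addr0// -addrA [w + v]addrC.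
Qed.

Lemma central_inj : injective central.
Proof.
move=> v w /(congr1 (fun f : bijection space => (f (0, false, 0)).2)).
by rewrite !action_fibre/= asboolT// !add0r.
Qed.

(** The unit vectors are the values of [monomials] at the [r]-subsets, hence realized by
    [central_word], and they span the cube. *)
Lemma stage_in_gens r (q : Q r) :
  smallest (@subgroup (bijection space)) lamp_gens (central (stage q)).
Proof.
rewrite (cube_unit_sum q).
apply: (big_ind (fun q => smallest (@subgroup _) lamp_gens (central (stage
  q)))).
- rewrite stage0 (_ : central 0 = 1%g);
  first by have [] := smallest_subgroup lamp_gens.
  apply: bijection_eq => z; rewrite action_fibre if_same addr0.
  by case: z.
- move=> x y gx gy; rewrite stageD -centralD.
  by have [_ gM _] := smallest_subgroup lamp_gens; exact: gM.
- move=> A _; rewrite -monomials_rset -color_stage_lamps -central_wordE.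
  exact: gvalP.
Qed.

Definition cube_elt r (q : Q r) : lamp_group := Generated (stage_in_gens q).

Lemma cube_eltD r (q q' : Q r) : cube_elt (q + q') = (cube_elt q * cube_elt
  q')%g.
Proof. by apply: gval_inj => /=; rewrite stageD -centralD. Qed.

Lemma cube_eltV r (q : Q r) : (cube_elt q)^-1%g = cube_elt q.
Proof.
apply: mulg1_eq; rewrite -cube_eltD cube_addxx.
by apply: (mulgI (cube_elt (0 : Q r))); rewrite -cube_eltD addr0 mulg1.
Qed.

Lemma cube_elt_inj r : injective (@cube_elt r).
Proof. by move=> q q' /(congr1 (@gval _ _)) /central_inj /stage_inj. Qed.

Lemma cube_elt_monomials r h :
  cube_elt (monomials r h) = central_word (@stage_lamps r h).
Proof. by apply: gval_inj; rewrite central_wordE color_stage_lamps. Qed.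

(** * Word lengths *)

Section WordLength.
Variables (Gr : groupType) (S : set Gr).
Hypothesis fsgS : finite_symmetric_generating S.
Implicit Types g h : Gr.

Lemma word_of_size_cat g h m n :
  word_of_size S g m -> word_of_size S h n -> word_of_size S (g * h)%g (m + n).
Proof.
move=> [v [<- vS <-]] [w [<- wS <-]]; exists (v ++ w); split.
- exact: size_cat.
- by move=> x; rewrite mem_cat => /orP[/vS|/wS].
- by rewrite big_cat.
Qed.

Lemma word_of_size_inv g n : word_of_size S g n -> word_of_size S g^-1%g n.
Proof.
move=> [v [<- vS <-]]; elim: v vS => [|x v IH] vS.
  by exists nil; rewrite big_nil invg1.
rewrite big_cons invgM /= -addn1; apply: word_of_size_cat.
  by apply: IH => y yv; apply: vS; rewrite inE yv orbT.
exists [:: x^-1%g]; split=> //; last by rewrite big_seq1.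
by move=> y; rewrite inE => /eqP ->; have [_ + _] := fsgS; apply; apply: vS;
  rewrite inE eqxx.
Qed.

Lemma word_of_size_exists g : exists n, word_of_size S g n.
Proof.
have [_ _ gS] := fsgS.
apply: (@generates_ind _ _ (fun g => exists n, word_of_size S g n) gS).
- split; first by exists 0%N, nil; rewrite big_nil.
    by move=> x y [m xm] [n yn]; exists (m + n)%N; exact: word_of_size_cat.
  by move=> x [m xm]; exists m; exact: word_of_size_inv.
- move=> x Sx; exists 1%N, [:: x]; split=> //; last by rewrite big_seq1.
  by move=> y; rewrite inE => /eqP ->.
Qed.

Lemma word_lengthP g : word_of_size S g (word_length S g) /\
  forall m, word_of_size S g m -> (word_length S g <= m)%N.
Proof.
apply: (xgetPex 0%N (P := [set n | word_of_size S g n /\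
  forall m, word_of_size S g m -> (n <= m)%N])).
have [n gn] := word_of_size_exists g.
have ex : exists n, `[< word_of_size S g n >] by exists n; exact/asboolP.
exists (ex_minn ex); case: ex_minnP => m /asboolP gm mmin; split=> // k gk.
by apply: mmin; exact/asboolP.
Qed.

Lemma word_length1 : word_length S 1%g = 0%N.
Proof.
apply/eqP; rewrite -leqn0; apply: (word_lengthP _).2.
by exists nil; rewrite big_nil.
Qed.

Lemma word_lengthM g h :
  (word_length S (g * h)%g <= word_length S g + word_length S h)%N.
Proof.
by apply: (word_lengthP _).2; apply: word_of_size_cat;
  exact: (word_lengthP _).1.
Qed.

Lemma word_lengthV g : (word_length S g^-1%g <= word_length S g)%N.
Proof.
by apply: (word_lengthP _).2; apply: word_of_size_inv;
  exact: (word_lengthP _).1.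
Qed.

Lemma word_length_conj g h :
  (word_length S (g^-1 * h * g)%g <= 2 * word_length S g + word_length S h)%N.
Proof.
apply: leq_trans (word_lengthM _ _) _; rewrite mul2n -addnn addnAC leq_add2r.
by apply: leq_trans (word_lengthM _ _) _; rewrite leq_add2r word_lengthV.
Qed.

Lemma word_lengthX g n : (word_length S (g ^+ n)%g <= n * word_length S g)%N.
Proof.
elim: n => [|n IH]; first by rewrite expg0 word_length1.
by rewrite expgS mulSn (leq_trans (word_lengthM _ _))// leq_add2l.
Qed.

Lemma word_length_prod I (s : seq I) (F : I -> Gr) B :
  (forall i, word_length S (F i) <= B)%N ->
  (word_length S (\prod_(i <- s) F i)%g <= size s * B)%N.
Proof.
move=> FB; elim: s => [|i s IH]; first by rewrite big_nil word_length1.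
by rewrite big_cons /= mulSn (leq_trans (word_lengthM _ _))// leq_add.
Qed.

Lemma ball_card : exists t, forall (T : finType) (F : T -> Gr) D, injective F ->
  (#|[pred x | word_length S (F x) <= D]| <= t ^ D)%N.
Proof.
have [/finite_seqP[s Ss] _ _] := fsgS.
(* The additional letter, of index 0, is the identity; it pads every word to length exactly [D]. *)
exists (size s).+1 => T F D injF; set A := [pred x | _].
pose letter (i : 'I_(size s).+1) : Gr := nth 1%g (1%g :: s) i.
have word g : (word_length S g <= D)%N ->
    exists w : D.-tuple 'I_(size s).+1, (\prod_(i <- w) letter i)%g = g.
  move=> gD; have [[v [vl vS <-]] _] := word_lengthP g.
  have vs : size [seq inord (index x s).+1 : 'I_(size s).+1 | x <- v] =
    word_length S g.
    by rewrite size_map.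
  have wD : size ([seq inord (index x s).+1 : 'I_(size s).+1 | x <- v] ++
      nseq (D - word_length S g) ord0) == D.
    by rewrite size_cat vs size_nseq subnKC.
  exists (Tuple wD); rewrite big_cat/= [X in (_ * X)%g]big1_seq; last first.
    by move=> i /andP[_]; rewrite mem_nseq => /andP[_ /eqP ->].
  rewrite mulg1 big_map big_seq [RHS]big_seq; apply: eq_bigr => x xv.
  have xs : x \in s by have := vS x xv; rewrite Ss.
  by rewrite /letter inordK ?ltnS ?index_mem//= nth_index.
have /choice[W WP] : forall x, exists w : D.-tuple 'I_(size s).+1,
    x \in A -> (\prod_(i <- w) letter i)%g = F x.
  move=> x; case: (boolP (x \in A)) => [xA|_];
    last by exists [tuple of nseq D ord0].
  by have [w wx] := word _ xA; exists w.
rewrite (_ : _ ^ D = #|{: D.-tuple 'I_(size s).+1}|)%N; last first.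
  by rewrite card_tuple card_ord.
rewrite -(card_in_imset (f := W) (D := A)) ?max_card//.
by move=> x y xA yA /= Wxy; apply: injF; rewrite -WP// -[RHS]WP// Wxy.
Qed.

End WordLength.

Section CubeLengths.
Variable S : set lamp_group.
Hypothesis fsgS : finite_symmetric_generating S.
Local Notation len := (word_length S).

(** The word uses at most [nvars r + 1] flips, each at a lamp of index at most [2 * nvars r] and
    hence of length linear in [nvars r]. *)
Lemma cube_elt_length : exists L0, forall r (h : {set 'I_(nvars r)}),
  (0 < r)%N -> (len (cube_elt (monomials r h)) <= L0 * nvars r ^ 2)%N.
Proof.
pose B := (len shift_elt + len flip_elt + len swap_elt + len paint_elt)%N.
exists (60 * B)%N => r h r0; rewrite cube_elt_monomials; set M := nvars r.
have rM : (2 * r <= M)%N.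
  by rewrite /M /nvars mulnC leq_mul2l -[X in (X <= _)%N]expn1 leq_exp2l// r0
    orbT.
have ME : M = nvars r by [].
clearbody M; have flip_len k : (k <= 2 * M)%N -> (len (flip_at k) <= (4 * M +
  1) * B)%N.
  move=> kM; apply: leq_trans (word_length_conj fsgS (shift_elt ^+ k)%g
    flip_elt) _.
  rewrite mulnDl mul1n leq_add//; last by rewrite /B; lia.
  rewrite -[4%N]/(2 * 2)%N -!mulnA leq_mul2l/= mulnA.
  apply: leq_trans (word_lengthX fsgS shift_elt k) _.
  by rewrite leq_mul// /B -!addnA leq_addr.
have flips_len : (len (flips (stage_lamps h)) <= 7 * (M ^ 2 * B))%N.
  (* [word_length_prod] asks for a bound at every index, so lamps beyond [2 * M], which do not occur
     here, are replaced by the identity. *)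
  pose F k := if (k <= 2 * M)%N then flip_at k else 1%g.
  have -> : flips (stage_lamps h) = (\prod_(k <- stage_lamps h) F k)%g.
    apply: eq_big_seq => k; rewrite /F inE => /orP[/eqP ->|/mapP[i _ ->]].
      by rewrite ifT//; lia.
    by rewrite ifT// leq_mul2l/= ME ltnW.
  apply: (@leq_trans (size (stage_lamps h) * ((4 * M + 1) * B))).
    apply: word_length_prod => // k; rewrite /F;
      case: ifP => // [/flip_len//|_].
    by rewrite word_length1.
  rewrite !mulnA leq_mul2r; apply/orP; right.
  have : (size (stage_lamps h) <= M + 1)%N.
    by rewrite /= size_map -cardE addn1 ltnS (leq_trans (max_card _))//
      card_ord ME.
  have : (2 <= M)%N by lia.
  move: (size _) => z.
  by nia.
rewrite /central_word; set f := flips _ in flips_len *.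
set p := (f^-1 * paint_elt * f)%g.
have p_len : (len p <= 2 * len f + len paint_elt)%N by exact: word_length_conj.
apply: (@leq_trans (2 * (len swap_elt + len p))).
  rewrite mul2n -addnn addnA; apply: leq_trans (word_lengthM fsgS _ _) _.
  rewrite leq_add2r; apply: leq_trans (word_lengthM fsgS _ _) _.
  by rewrite leq_add2r; exact: word_lengthM.
have : (B <= M ^ 2 * B)%N by rewrite leq_pmull// expn_gt0; lia.
have : (len swap_elt + len paint_elt <= B)%N by rewrite /B; lia.
rewrite (_ : 60 * B * M ^ 2 = 60 * (M ^ 2 * B))%N; last by ring.
move: p_len flips_len; move: (M ^ 2 * B)%N (len p) (len f) (len swap_elt) (len
  paint_elt) => x a b c d.
by lia.
Qed.

Lemma cube_elt_ball : exists t, forall r D,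
  (#|[pred q : {ffun rset (nvars r) r -> bool} | len (cube_elt q) <= D]| <= t ^
    D)%N.
Proof.
have [t tP] := ball_card fsgS; exists t => r D.
exact: tP (@cube_elt_inj r).
Qed.

End CubeLengths.

(** * Compression *)

Section NoEmbedding.
Variables (R : realType) (S : set lamp_group) (p : R) (p1 : (1 <= p%:E)%E)
  (alpha : R).
Hypotheses (fsgS : finite_symmetric_generating S) (alpha0 : 0 < alpha).
Variables (f : lamp_group -> Lp p1) (c : R).
Hypothesis c0 : 0 < c.
Hypothesis fP : forall g h : lamp_group,
  ((c * powR (word_metric S g h)%:R alpha)%:E <= Lp_dist (f g) (f h)
     <= ((word_metric S g h)%:R)%:E)%E.

Local Notation len := (word_length S).

Let p_ge1 : 1 <= p. Proof. by rewrite -lee_fin. Qed.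
Let p_gt0 : 0 < p. Proof. exact: lt_le_trans ltr01 p_ge1. Qed.

Lemma word_metric_cube r (x y : Q r) :
  word_metric S (cube_elt (x + y)) (cube_elt x) = len (cube_elt y).
Proof. by rewrite /word_metric cube_eltV -cube_eltD addrAC cube_addxx add0r.
  Qed.

Lemma cube_dist_le r (x y : Q r) L : (len (cube_elt y) <= L)%N ->
  ((Lp_dist (f (cube_elt (x + y)%R)) (f (cube_elt x))) `^ p <= (L%:R `^
    p)%:E)%E.
Proof.
move=> yL; rewrite -poweR_EFin.
have /andP[_] := fP (cube_elt (x + y)) (cube_elt x).
rewrite word_metric_cube => dist_le.
have {}dist_le : (Lp_dist (f (cube_elt (x + y)%R)) (f (cube_elt x)) <=
  L%:R%:E)%E.
  by apply: le_trans dist_le _; rewrite lee_fin ler_nat.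
apply: gt0_ler_poweR => //; first exact: ltW.
  by rewrite in_itv/= leey andbT /Lp_dist Lnorm_ge0.
by rewrite in_itv/= leey andbT lee_fin.
Qed.

Lemma cube_dist_ge r (x y : Q r) D : (D <= len (cube_elt y))%N ->
  (((c * D%:R `^ alpha) `^ p)%:E <=
   (Lp_dist (f (cube_elt (x + y)%R)) (f (cube_elt x))) `^ p)%E.
Proof.
move=> yD; rewrite -poweR_EFin.
have /andP[+ _] := fP (cube_elt (x + y)) (cube_elt x).
rewrite word_metric_cube => dist_ge.
have dist_geD : ((c * D%:R `^ alpha)%:E <=
    Lp_dist (f (cube_elt (x + y)%R)) (f (cube_elt x)))%E.
  apply: le_trans dist_ge; rewrite lee_fin ler_pM2l//.
  by rewrite ge0_ler_powR ?nnegrE ?ler_nat// ltW.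
apply: gt0_ler_poweR => //; first exact: ltW.
  by rewrite in_itv/= leey andbT lee_fin mulr_ge0 ?powR_ge0// ltW.
by rewrite in_itv/= leey andbT /Lp_dist Lnorm_ge0.
Qed.

(** The Poincare inequality with gap [2 ^- r] is applied to [f] on the cube. The directions
    [monomials r h] are short, which bounds the right side, while at least half of all directions
    have length at least [D], which bounds the left. This half turns 32 into 64. *)
Lemma stage_inequality : exists L t P : nat, forall r D, (0 < r)%N ->
  (2 * t ^ D <= 2 ^ 2 ^ (r * r))%N ->
  (2 ^- r) * (c * D%:R `^ alpha) `^ p <=
  64 * (16 * P%:R * 2 ^+ r) `^ p * ((L * nvars r ^ 2)%:R `^ p).
Proof.
have [L LP] := cube_elt_length fsgS; have [t tP] := cube_elt_ball fsgS.
pose P := Num.bound p; exists L, t, P => r D r0 tD.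
have pP : p <= P%:R by rewrite ltW// archi_boundP// ltW.
set M := nvars r; set B := (L * M ^ 2)%N.
have rM : (r <= M)%N by rewrite /M /nvars leq_pmulr// expn_gt0.
pose H : finType := {set 'I_M}.
have cH : #|H| = (2 ^ M)%N by rewrite /H -cardsT -powersetT card_powerset
  cardsT card_ord.
have lam01 : 0 < (2 ^- r : R) <= 1.
  by rewrite invr_gt0 exprn_gt0//= invf_le1 ?exprn_gt0// exprn_ege1// ler1n.
have [lam0 _] := andP lam01.
have gap (w : Q r) : w != 0 ->
    2 ^- r * #|H|%:R <= #|[pred h | dot w (monomials r h)]|%:R :> R.
  move=> /reed_muller_gap w0; apply: le_trans (_ : (2 ^ (M - r))%:R <= _).
    rewrite cH natrX ler_pdivrMl ?exprn_gt0// natrX -exprD subnKC//.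
  by rewrite ler_nat.
have := poincare_Lp (f \o @cube_elt r) lam01 gap pP.
set q := #|{: Q r}|; set K := (c * _) `^ p; set E := _ `^ p.
have q0 : (0 < q)%N by apply/card_gt0P; exists 0.
(* Since [nvars r = r * 2 ^ r], the dimension of the cube is at least [(2 ^ r) ^ r]; the ball of
   radius [D] thus fills at most half of it. *)
have tq : (2 * t ^ D <= q)%N.
  apply: leq_trans tD _; rewrite /q card_ffun card_bool card_rset leq_exp2l//.
  by apply: leq_trans (binomial_lower_bound _ _); rewrite -expnM.
have K0 : 0 <= K by rewrite powR_ge0.
have E0 : 0 <= E by rewrite powR_ge0.
move=> PI.
have lower : ((2^-1 * q%:R * q%:R * K)%:E <= \sum_(y : Q r) \sum_(x : Q r)
    (Lp_dist ((f \o @cube_elt r) (x + y)%R) ((f \o @cube_elt r) x)) `^ p)%E.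
  pose far (y : Q r) := (D <= len (cube_elt y))%N.
  apply: (@le_trans _ _ (\sum_(y : Q r) \sum_(x : Q r) (K *+ far y)%:E)%E).
    under eq_bigr do rewrite sumEFin.
    rewrite sumEFin lee_fin.
    under eq_bigr do rewrite sumr_const.
    rewrite (eq_bigr (fun y => (K * q%:R) *+ far y)) => [|y _]; last first.
      by rewrite mulr_natr -!mulrnA mulnC.
    rewrite sumrMnr (_ : (\sum_y far y)%N = #|[pred y | far y]|); last first.
      by rewrite -sum1_card [RHS]big_mkcond; apply: eq_bigr => y _;
        rewrite inE; case: far.
    have far_card : (q <= 2 * #|[pred y | far y]|)%N.
      have := cardC [pred y | far y]; rewrite -/q => cC.
      have near : (#|[predC [pred y | far y]]| <= t ^ D)%N.
        apply: leq_trans (tP r D); apply: subset_leq_card.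
        by apply/fintype.subsetP => y; rewrite !inE -ltnNge => /ltnW.
      move: cC near tq; move: (t ^ D)%N => u; clearbody q.
      by move: #|_| #|_| => a b; lia.
    rewrite -(mulr_natr (K * _)); move: far_card; rewrite -(ler_nat R) natrM.
    move: #|_| => n fc.
    rewrite (_ : 2^-1 * q%:R * q%:R * K = K * q%:R * (2^-1 * q%:R));
      last by ring.
    by rewrite ler_wpM2l ?mulr_ge0//; lra.
  apply: lee_sum => y _; apply: lee_sum => x _; rewrite /far.
  case: leqP => [yD|_]; first by rewrite mulr1n; exact: cube_dist_ge.
  by rewrite mulr0n poweR_ge0.
have upper : (\sum_(h : H) \sum_(x : Q r)
    (Lp_dist ((f \o @cube_elt r) (x + monomials r h)%R) ((f \o @cube_elt r) x))
      `^ p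
    <= (#|H|%:R * q%:R * B%:R `^ p)%:E)%E.
  apply: (@le_trans _ _ (\sum_(h : H) \sum_(x : Q r) (B%:R `^ p)%:E)%E).
    apply: lee_sum => h _; apply: lee_sum => x _.
    by apply: cube_dist_le; exact: LP.
  under eq_bigr do rewrite sumEFin.
  rewrite sumEFin lee_fin.
  under eq_bigr do rewrite sumr_const.
  rewrite sumr_const -[leLHS]mulr_natl -[X in _ * X <= _]mulr_natl mulrA.
  exact: lexx.
have H0 : 0 < #|H|%:R :> R by rewrite cH ltr0n expn_gt0.
have qR0 : 0 < q%:R :> R by rewrite ltr0n.
have : ((2 ^- r * #|H|%:R)%:E * (2^-1 * q%:R * q%:R * K)%:E <=
    (32 * E * q%:R)%:E * (#|H|%:R * q%:R * B%:R `^ p)%:E)%E.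
  apply: le_trans (_ : _ <= (2 ^- r * #|H|%:R)%:E * _)%E _.
    by apply: lee_wpmul2l lower; rewrite lee_fin mulr_ge0// ltW.
  apply: le_trans PI _.
  by apply: lee_wpmul2l upper; rewrite lee_fin !mulr_ge0.
rewrite -!EFinM lee_fin /E invrK.
set E' := (16 * _ * _) `^ p.
rewrite (_ : 2 ^- r * _ * _ = #|H|%:R * q%:R * q%:R * (2^-1 * (2 ^- r * K)));
  last by ring.
rewrite (_ : 32 * _ * _ * _ = #|H|%:R * q%:R * q%:R * (32 * E' * B%:R `^ p));
  last by ring.
rewrite ler_pM2l ?mulr_gt0// ler_pdivrMl// => /le_trans; apply.
by rewrite !mulrA -natrM.
Qed.

Lemma no_embedding : False.
Proof.
have [L [t [P PI]]] := stage_inequality.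
have [A AE] : exists A : R, A = 1024 * P%:R * L%:R by eexists.
have [m mE] : exists m, 7 / alpha < m%:R.
  by exists (Num.bound (7 / alpha)); rewrite archi_boundP// divr_ge0// ltW.
have [n nE] : exists n, A / c < 2 ^+ n by exists (Num.bound (A / c));
  exact: upper_nthrootP.
(* The summand [t + 2] serves the ball condition [tD], [m] makes [D] to the power [alpha] at least
   [2 ^ (7 * r)], and [n] makes [c * 2 ^ r] exceed [A]. *)
pose r := (t + 2 + m + n)%N.
have r0 : (0 < r)%N by rewrite /r; lia.
(* The exponent is quadratic in [r], against linear exponents in the upper bound; [r - 1] in place
   of [r] leaves room for the factor [t]. *)
pose D := (2 ^ (r * (r - 1)))%N.
have tD : (2 * t ^ D <= 2 ^ 2 ^ (r * r))%N.
  apply: (@leq_trans (2 ^ (1 + t * D))).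
    by rewrite expnD expnM leq_mul2l/= leq_exp2r ?expn_gt0// ltnW// ltn_expl.
  rewrite leq_exp2l//; apply: (@leq_trans (2 ^ r * D)).
    have D0 : (0 < D)%N by rewrite expn_gt0.
    have : (r < 2 ^ r)%N by rewrite ltn_expl.
    by rewrite /r; nia.
  rewrite /D -expnD leq_exp2l//.
  by rewrite -{1}(muln1 r) -mulnDr subnKC// /r; lia.
have := PI r D r0 tD.
set B := (L * nvars r ^ 2)%N => main.
have D7 : 2 ^+ (7 * r) <= D%:R `^ alpha :> R.
  rewrite /D natrX -[X in _ <= X `^ _]powR_mulrn// -powRrM -powR_mulrn//.
  rewrite ler_powR ?ler1n// !natrM mulrC -mulrA ler_wpM2l// -ler_pdivrMr//.
  by apply: le_trans (ltW mE) _; rewrite ler_nat /r; lia.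
(* The prefactor is at least 1 and [p >= 1], so it can be put under the p-th power before the root
   is taken. *)
have p2 : 2 ^+ r * 64 <= (2 ^+ r * 64) `^ p :> R.
  rewrite le1r_powR//.
  by rewrite -natrX -natrM ler1n muln_gt0 expn_gt0.
have X0 : 0 <= c * D%:R `^ alpha by rewrite mulr_ge0 ?powR_ge0// ltW.
have root : c * D%:R `^ alpha <= 2 ^+ r * 64 * (16 * P%:R * 2 ^+ r) * B%:R.
  rewrite leNgt; apply/negP => lt.
  have := gt0_ltr_powR p_gt0 _ _ lt.
  rewrite !nnegrE X0 !mulr_ge0// => /(_ isT isT); apply/negP; rewrite -leNgt.
  rewrite [leRHS]powRM ?mulr_ge0// [X in _ <= X * _]powRM ?mulr_ge0//.
  move: main; rewrite ler_pdivrMl ?exprn_gt0// => /le_trans; apply.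
  by rewrite !mulrA 2?ler_wpM2r ?powR_ge0.
have r2 : (r%:R ^+ 2 <= 2 ^+ (2 * r) :> R).
  by rewrite -natrX -natrX ler_nat mulnC expnM leq_exp2r// ltnW// ltn_expl.
have BE : B%:R = L%:R * (r%:R ^+ 2 * 2 ^+ (2 * r)) :> R.
  by rewrite /B /nvars natrM natrX natrM natrX exprMn -exprM mulnC.
(* The right side of [root] is [A * 2 ^ (4 * r) * r ^ 2], at most [A * 2 ^ (6 * r)]; the exponent
   [7 * r] in [D7] leaves a factor [2 ^ r] to spare. *)
have : c * 2 ^+ r <= A.
  have z0 : 0 < 2 ^+ (4 * r + 2 * r) :> R by rewrite exprn_gt0.
  rewrite -(ler_pM2r z0) -mulrA -exprD -mulnDl -mulSn.
  apply: le_trans (ler_wpM2l (ltW c0) D7) (le_trans root _).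
  rewrite BE [leLHS](_ : _ = A * (2 ^+ (4 * r) * r%:R ^+ 2)); last first.
    rewrite AE (mulnC 4) (mulnC 2) !exprM.
    by move: (2 ^+ r) r%:R P%:R L%:R => u v w x; ring.
  have A0 : 0 <= A by rewrite AE -!natrM ler0n.
  by rewrite mulnDl exprD !ler_wpM2l.
rewrite -ler_pdivlMl// mulrC leNgt (lt_le_trans nE)//.
by rewrite ler_eXn2l ?ltr1n// leq_addl.
Qed.

End NoEmbedding.

Theorem theorem1p1 (R : realType) :
  exists G : groupType,
    [/\ finitely_generated G, amenable R G
      & forall S : set G, finite_symmetric_generating S ->
        forall (p : R) (p1 : (1 <= p%:E)%E) (alpha : R), 0 < alpha ->
        ~ exists f : G -> Lp p1,
            injective f /\
            exists c : R, 0 < c /\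
              forall g h : G,
                ((c * powR (word_metric S g h)%:R alpha)%:E
                   <= Lp_dist (f g) (f h)
                   <= ((word_metric S g h)%:R)%:E)%E].
Proof.
exists lamp_group; split.
- exact: finitely_generated_lamp_group.
- exact: amenable_lamp_group.
move=> S fsgS p p1 alpha alpha0 [f [_ [c [c0 fP]]]].
exact: (no_embedding fsgS alpha0 c0 fP).
Qed.
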